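(* Let $K$ be a field of characteristic $p$, let $U$ be a coherent good set of valuations on $K$, and let $K_0\subseteq K$ be the field of constants of $U$. Let $\phi:A\to K\{\tau\}$ be a Drinfeld module of positive relative modular transcendence degree over $K_0$. Let $t\in A$ be non-constant and assume $\phi_t=\sum_{i=0}^r a_i\tau^i$ is monic ($a_r=1$). Let $S_0$ be the set of places in $U$ of bad reduction for $\phi$, and $s=|S_0|$. Then for every non-torsion point $x\in K^{\mathrm{per}}$ (the perfect closure of $K$), $$\hat h(x)>\frac{\min_{v_0\in S_0}d(v_0)}{q^{4r(r+1)^2s+3r}}>0.$$
   Context: Setting: $p$ prime, $q$ a power of $p$, $A$ the ring of functions on a nonsingular projective curve over $\mathbb{F}_q$ regular away from a fixed closed point; $K\supseteq\mathbb{F}_q$. $K\{\tau\}$ twisted polynomials with $\tau(x)=x^q$. A Drinfeld module $\phi:A\to K\{\tau\}$ is a ring morphism with $\tau^0$-coefficient of $\phi_a$ equal to $i(a)$ (fixed $i:A\to K$), not all $\phi_a$ of degree $0$ in $\tau$. $\deg(\phi_a)$ is the degree of $\phi_a$ as a polynomial in $x$. Torsion: $\phi_a(x)=0$ for some nonzero $a$. Bad reduction at $v$: for some nonzero $a$ some coefficient of $\phi_a$ is non-integral at $v$ or the leading coefficient is not a $v$-unit. Field of definition: smallest field containing all coefficients of all $\phi_a$; $\phi^{(\gamma)}_a=\gamma^{-1}\phi_a\gamma$; relative modular transcendence degree over $K_0$: minimum over $\gamma\in K^{\mathrm{alg}}\setminus\{0\}$ of the transcendence degree over $K_0$ of the compositum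 of $K_0$ and the field of definition of $\phi^{(\gamma)}$. Valuations are discrete, normalized with value group $\mathbb{Z}$. A good set of valuations: set $U$ with degrees $d:U\to\mathbb{R}_{>0}$, each nonzero $x$ has $v(x)\ne0$ for finitely many $v$, and $\sum_{v\in U}d(v)v(x)=0$; field of constants $\{0\}\cup\{x:v(x)=0\,\forall v\in U\}$. $v$ is coherent if $\sum_{w|v}e(w|v)f(w|v)=[L:K]$ for all finite $L/K$; extensions get degree $d(w)=f(w|v)d(v)/[L:K]$. $U$ is coherent if all its valuations are coherent and for each finite $L/K$ the set $U_L$ of extensions (with these degrees) is a good set on $L$. Heights: for finite $L/K$, $w\in U_L$, $y\in L$: $\hat h_w(y)=-d(w)\lim_n\min\{0,w(\phi_{a^n}(y))\}/\deg(\phi_{a^n})$ for non-constant $a\in A$; $\hat h(y)=\sum_{w\in U_L}\hat h_w(y)$, independent of $L$. *)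

(* Defs.v *)
From HB Require Import structures.
From mathcomp Require Import all_boot all_order all_algebra all_field.
From mathcomp Require Import finmap.
From mathcomp Require Import all_classical all_reals all_analysis.
From mathcomp Require Import -(notations,coercions) mpoly.

Set Implicit Arguments.
Unset Strict Implicit.
Unset Printing Implicit Defensive.

Import Order.TTheory GRing.Theory Num.Theory.
Import numFieldNormedType.Exports.

Local Open Scope classical_set_scope.
Local Open Scope ring_scope.

Section Subfields.
Context {F : fieldType}.
Implicit Types E : set F.

Definition gen_subfield (S : set F) : set F :=
  smallest (fun E => GRing.divring_closed (fun x => x \in E)) S.

Definition compositum E1 E2 : set F := gen_subfield (E1 `|` E2).

Definition alg_independent (k : set F) (n : nat) (z : 'I_n -> F) : Prop :=
  forall P : mpoly.mpoly n F,
    (forall m, k (mpoly.mcoeff m P)) -> mpoly.meval z P = 0 -> P = 0.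

(* A supremum of natural numbers in [\bar R]; the value is [+oo] exactly when
   there are arbitrarily large algebraically independent families. *)
Definition trdeg (R : realType) (k E : set F) : \bar R :=
  ereal_sup [set n%:R%:E | n in [set n : nat | exists z : 'I_n -> F,
    (forall i, E (z i)) /\ alg_independent k z]].

End Subfields.

(* Normalized discrete valuations: the value group is all of Z, and
   [v 0 = +oo]. *)
Record valuation (K : fieldType) (v : K -> \bar int) : Prop := Valuation {
  val_zero : v 0 = +oo%E ;
  val_fin : forall x : K, x != 0 -> v x \is a fin_num ;
  val_mul : forall x y, v (x * y) = (v x + v y)%E ;
  val_add : forall x y, (mine (v x) (v y) <= v (x + y)%R)%E ;
  val_onto : forall n : int, exists x, v x = n%:E }.

Section Extensions.
Context {K : fieldType} {L : fieldExtType K}.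
Implicit Types (w : L -> \bar int) (v : K -> \bar int).

Definition is_ramification w v (e : nat) : Prop :=
  (0 < e)%N /\ forall x : K, w x%:A = ((e%:Z)%:E * v x)%E.

Definition lies_over w v : Prop :=
  valuation w /\ exists e, is_ramification w v e.

Definition ramification w v : nat := xget 0%N (is_ramification w v).

(* The residue classes of the b i form a basis of the residue field of w over
   the residue field of v. *)
Definition residue_basis w v (n : nat) (b : 'I_n -> L) : Prop :=
  [/\ forall i, (0 <= w (b i))%E,
      forall y, (0 <= w y)%E ->
        exists2 c : 'I_n -> K, forall i, (0 <= v (c i))%E &
          (0 < w (y - \sum_i c i *: b i)%R)%E
    & forall c : 'I_n -> K, (forall i, (0 <= v (c i))%E) ->
        (0 < w (\sum_i c i *: b i)%R)%E -> forall i, (0 < v (c i))%E].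

Definition residue_degree w v : nat :=
  xget 0%N [set f : nat | exists b : 'I_f -> L, residue_basis w v b].

End Extensions.

Definition coherent_valuation (K : fieldType) (v : K -> \bar int) : Prop :=
  forall L : fieldExtType K,
    \big[addn/0%N]_(w \in [set w : L -> \bar int | lies_over w v])
       (ramification w v * residue_degree w v)%N = \dim {:L}.

Record good_set (R : realType) (K : fieldType) (U : set (K -> \bar int))
    (d : (K -> \bar int) -> R) : Prop := GoodSet {
  good_val : forall v, U v -> valuation v ;
  good_deg : forall v, U v -> 0 < d v ;
  good_fin : forall x : K, x != 0 -> finite_set [set v | U v /\ v x != 0%E] ;
  good_sum : forall x : K, x != 0 ->
    \sum_(v \in U) d v * (fine (v x))%:~R = 0 }.

Definition constants (K : fieldType) (U : set (K -> \bar int)) : set K :=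
  [set x | x = 0 \/ forall v, U v -> v x = 0%E].

Section ExtendedSet.
Context {R : realType} {K : fieldType}.
Variables (U : set (K -> \bar int)) (d : (K -> \bar int) -> R).
Variable L : fieldExtType K.

Definition ext_set : set (L -> \bar int) :=
  [set w | exists2 v, U v & lies_over w v].

(* The unique v in U below w. *)
Definition val_below (w : L -> \bar int) : K -> \bar int :=
  xget (fun=> 0%E) [set v | U v /\ lies_over w v].

Definition ext_deg (w : L -> \bar int) : R :=
  (residue_degree w (val_below w))%:R * d (val_below w) / (\dim {:L})%:R.

End ExtendedSet.

Arguments ext_set {K} U L.
Arguments ext_deg {R K} U d L.

Record coherent_good_set (R : realType) (K : fieldType)
    (U : set (K -> \bar int)) (d : (K -> \bar int) -> R) : Prop :=
  CoherentGoodSet {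
    coh_good : good_set U d ;
    coh_val : forall v, U v -> coherent_valuation v ;
    coh_ext : forall L : fieldExtType K,
      good_set (ext_set U L) (ext_deg U d L) }.

(* A nonsingular projective curve over k is given by its function field F,
   a finitely generated extension of k of transcendence degree 1; its closed
   points are the normalized discrete valuations of F trivial on k. *)
Section Curves.
Context {k F : fieldType} (j : {rmorphism k -> F}).

Definition function_field (R : realType) : Prop :=
  (exists s : seq F, gen_subfield (range j `|` [set` s]) = setT) /\
  trdeg R (range j) setT = 1%E.

Definition closed_point (v : F -> \bar int) : Prop :=
  valuation v /\ forall c, c != 0 -> v (j c) = 0%E.

Definition regular_away (vinf : F -> \bar int) : set F :=
  [set f | forall v, closed_point v -> v <> vinf -> (0 <= v f)%E].

(* The constant functions are those algebraic over k; they are the elements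
   of k when the curve is geometrically irreducible. *)
Definition nonconstant (f : F) : Prop := ~ algebraicOver j f.

End Curves.

(* An element of K{tau} is encoded by the ordinary polynomial having the same
   coefficients: the coefficient of ['X^i] is that of tau^i. Addition is the
   usual one; multiplication is governed by tau c = c^q tau. *)
Section Twisted.
Variable q : nat.

Definition tmul (K : fieldType) (f g : {poly K}) : {poly K} :=
  \sum_(i < size f) \sum_(j < size g)
    (f`_i * g`_j ^+ (q ^ i)) *: 'X^(i + j).

(* The polynomial in x defined by f, with tau(x) = x^q. *)
Definition xpoly (K : fieldType) (f : {poly K}) : {poly K} :=
  \sum_(i < size f) f`_i *: 'X^(q ^ i).

Definition xdeg (K : fieldType) (f : {poly K}) : nat := (size (xpoly f)).-1.

Definition teval (K E : fieldType) (h : {rmorphism K -> E}) (f : {poly K})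
  (x : E) : E := (map_poly h (xpoly f)).[x].

End Twisted.

Record drinfeld_module (q : nat) (A : comNzRingType) (K : fieldType)
    (i : {rmorphism A -> K}) (phi : A -> {poly K}) : Prop := DrinfeldModule {
  drin_add : forall a b, phi (a + b) = phi a + phi b ;
  drin_one : phi 1 = 1 ;
  drin_mul : forall a b, phi (a * b) = tmul q (phi a) (phi b) ;
  drin_coef0 : forall a, (phi a)`_0 = i a ;
  drin_nontriv : exists a, (1 < size (phi a))%N }.

Section DrinfeldNotions.
Variables (R : realType) (q : nat) (A : comNzRingType) (K : fieldType).
Variable phi : A -> {poly K}.

Definition bad_reduction (v : K -> \bar int) : Prop :=
  exists2 a, a != 0 &
    (exists i : nat, (v (phi a)`_i < 0)%E) \/ v (lead_coef (phi a)) != 0%E.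

Definition torsion (E : fieldType) (h : {rmorphism K -> E}) (x : E) : Prop :=
  exists2 a, a != 0 & teval q h (phi a) x = 0.

Section Modular.
Context {Kalg : fieldType} (iK : {rmorphism K -> Kalg}).

Definition conj_drinfeld (g : Kalg) (a : A) : {poly Kalg} :=
  tmul q (tmul q (g^-1)%:P (map_poly iK (phi a))) g%:P.

Definition field_of_definition (psi : A -> {poly Kalg}) : set Kalg :=
  gen_subfield [set c | exists a (n : nat), c = (psi a)`_n].

(* The infimum is a minimum, being taken over a nonempty set of elements of
   the set of natural numbers extended by [+oo]. *)
Definition rel_modular_trdeg (K0 : set K) : \bar R :=
  ereal_inf [set trdeg R (iK @` K0)
                   (compositum (iK @` K0)
                               (field_of_definition (conj_drinfeld g)))
            | g in [set g : Kalg | g != 0]].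

End Modular.

Section Heights.
Variables (U : set (K -> \bar int)) (d : (K -> \bar int) -> R).
Variable L : fieldExtType K.

(* The value does not depend on the choice of a nonconstant a. *)
Definition local_height (a : A) (w : L -> \bar int) (y : L) : R :=
  - ext_deg U d L w *
    lim ((fun n : nat =>
            (fine (mine 0%E (w (teval q (in_alg L) (phi (a ^+ n)) y))))%:~R /
            (xdeg q (phi (a ^+ n)))%:R : R) @ \oo).

Definition height (a : A) (y : L) : R :=
  \sum_(w \in ext_set U L) local_height a w y.

End Heights.

End DrinfeldNotions.

Definition perfect_closure (p : nat) (K Kalg : fieldType)
  (iK : {rmorphism K -> Kalg}) : set Kalg :=
  [set x | exists n : nat, exists c : K, x ^+ (p ^ n) = iK c].

(* Main.v *)
(** The height is bounded from below in two ways. If z is nonzero, the sum formula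
    compares the height of z with the valuations of z at the places of bad
    reduction, because at a place of good reduction the local height dominates the
    polar part of z; hence the height is at least of order d(v) as soon as z has
    a zero of definite size at every bad place. On the other hand a sufficiently
    large pole at a bad place grows like q^r under phi_t, and makes the height at
    least d(v).

    Assume no multiple of x of small degree has such a large pole. For a bad
    place v let C = max(-v(a_i)) > 0. The points phi_P(x), for P in F_q[t] with
    deg P < N, form a group of order q^N. Interpolating phi_t at q^i + 1 points of
    this group bounds from below the valuation of one of their differences. Doing so
    for the leading coefficient, twice, and then for a dominant coefficient a_i with
    v(a_i) < 0, yields a subgroup of index at most q^(3r) on which v >= C / q^(2r).
    With N = 3rs + 1 this can be repeated at all s bad places and leaves a nonzero P
    for which phi_P(x) has a zero of definite size at each of them. Purely
    inseparable points have, up to the ramification index, the same valuation at all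
    the places above v, so one place above each v suffices. *)

Require Import Defs.
From HB Require Import structures.
From mathcomp Require Import all_boot all_order all_algebra all_field.
From mathcomp Require Import finmap.
From mathcomp Require Import all_classical all_reals all_analysis.
From mathcomp Require Import -(notations,coercions) mpoly.
From mathcomp Require Import zify ring lra.

Set Implicit Arguments.
Unset Strict Implicit.
Unset Printing Implicit Defensive.

Import Order.TTheory GRing.Theory Num.Theory.
Import numFieldNormedType.Exports.

Local Open Scope ring_scope.

(** * Discrete valuations *)

Section Valuations.
Context {L : fieldType} (w : L -> \bar int).

(** At 0, where [w] is infinite, [fine] returns the default value 0; hence the nonzero hypotheses in
    many statements about [vi]. *)
Definition vi (x : L) : int := fine (w x).

(** The disjunct [x == 0] restores the convention that 0 has infinite valuation, so that for a
    valuation these sets are additive subgroups. *)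
Definition vge (k : int) (x : L) : bool := (x == 0) || (k <= vi x).

Hypothesis hw : valuation w.

Lemma val_vi (x : L) : x != 0 -> w x = (vi x)%:E.
Proof. by move=> x0; rewrite /vi fineK //; apply: val_fin. Qed.

Lemma vgeE (k : int) (x : L) : vge k x = (k%:E <= w x)%E.
Proof.
rewrite /vge; case: eqVneq => [->|x0]; first by rewrite (val_zero hw) leey.
by rewrite val_vi.
Qed.

Lemma vge_vi (k : int) (x : L) : x != 0 -> vge k x = (k <= vi x).
Proof. by rewrite /vge => /negPf ->. Qed.

Lemma viM (x y : L) : x != 0 -> y != 0 -> vi (x * y) = vi x + vi y.
Proof. by move=> x0 y0; rewrite /vi (val_mul hw) !val_vi. Qed.

Lemma vi1 : vi 1 = 0.
Proof.
by apply: (addrI (vi 1)); rewrite addr0 -viM ?mulr1 ?oner_neq0.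
Qed.

Lemma viX (x : L) (n : nat) : x != 0 -> vi (x ^+ n) = n%:Z * vi x.
Proof.
move=> x0; elim: n => [|n IH]; first by rewrite expr0 vi1 mul0r.
by rewrite exprS viM ?expf_neq0 // IH -addn1 PoszD mulrDl mul1r addrC.
Qed.

Lemma viV (x : L) : x != 0 -> vi x^-1 = - vi x.
Proof.
by move=> x0; have := viM x0 (invr_neq0 x0); rewrite divff // vi1; lia.
Qed.

Lemma viN (x : L) : vi (- x) = vi x.
Proof.
have [->|x0] := eqVneq x 0; first by rewrite oppr0.
have N1 : (-1 : L) != 0 by rewrite oppr_eq0 oner_eq0.
have := viX 2 N1; rewrite sqrrN expr1n vi1 => h.
by rewrite -mulN1r viM //; lia.
Qed.

Lemma vge0 (k : int) : vge k 0.
Proof. by rewrite /vge eqxx. Qed.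

Lemma vge_le (k l : int) (x : L) : k <= l -> vge l x -> vge k x.
Proof. by rewrite /vge; case: eqP => //= _; lia. Qed.

Lemma vgeN (k : int) (x : L) : vge k (- x) = vge k x.
Proof. by rewrite /vge oppr_eq0 viN. Qed.

Lemma vgeD (k : int) (x y : L) : vge k x -> vge k y -> vge k (x + y).
Proof.
rewrite !vgeE => hx hy; apply: le_trans (val_add hw x y).
by rewrite le_min hx hy.
Qed.

Lemma vgeB (k : int) (x y : L) : vge k x -> vge k y -> vge k (x - y).
Proof. by move=> hx hy; rewrite vgeD ?vgeN. Qed.

Lemma vgeM (k l : int) (x y : L) : vge k x -> vge l y -> vge (k + l) (x * y).
Proof.
have [->|x0] := eqVneq x 0; first by rewrite mul0r => *; apply: vge0.
have [->|y0] := eqVneq y 0; first by rewrite mulr0 => *; apply: vge0.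
by rewrite !vge_vi ?mulf_neq0 // viM //; apply: lerD.
Qed.

Lemma vgeX (k : int) (n : nat) (x : L) : vge k x -> vge (n%:Z * k) (x ^+ n).
Proof.
have [->|x0] := eqVneq x 0.
  by case: n => [|n]; rewrite ?expr0n /= ?vge0 // vge_vi ?oner_neq0 // vi1 mul0r.
by rewrite !vge_vi ?expf_neq0 // viX //; apply: ler_wpM2l.
Qed.

Lemma vge_sum (I : Type) (s : seq I) (P : pred I) (F : I -> L) (k : int) :
  (forall i, P i -> vge k (F i)) -> vge k (\sum_(i <- s | P i) F i).
Proof.
move=> h; elim/big_rec: _ => [|i x Pi hx]; first exact: vge0.
by rewrite vgeD ?h.
Qed.

(** If [x + y] had larger valuation than [x], so would [x], as the difference of [x + y] and [y]. *)
Lemma vi_dominant (x y : L) : x != 0 -> vge (vi x + 1) y ->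
  x + y != 0 /\ vi (x + y) = vi x.
Proof.
move=> x0 hy.
have xy0 : x + y != 0.
  apply: contraTneq hy => /eqP; rewrite addr_eq0 => /eqP xE.
  by rewrite -vgeN -xE vge_vi // -ltNge; lia.
split=> //; apply/eqP; rewrite eq_le; apply/andP; split; last first.
  rewrite -vge_vi //; apply: vgeD; first by rewrite vge_vi.
  by apply: vge_le hy; lia.
rewrite leNgt; apply/negP => lt.
have : vge (vi x + 1) x.
    rewrite -[in X in vge _ X](addrK y x) vgeB // vge_vi //. by rewrite -ltzD1 ltrD2r.
by rewrite vge_vi //; lia.
Qed.

(* A Lagrange-interpolation estimate: the n-th divided difference of f at the
   points of zs has valuation b, while it is a combination of the values of f
   with denominators the products of n differences. *)
Lemma divided_difference_bound (dl tau : int) (zs : seq L) (n : nat) :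
  size zs = n.+1 -> all (vge (- dl)) zs ->
  pairwise (fun z z' => ~~ vge (tau + 1) (z - z')) zs ->
  forall (f : {poly L}) (b B : int),
    f`_n != 0 -> vi f`_n = b ->
    (forall m, (n < m)%N -> vge (b + (m%:Z - n%:Z) * dl + 1) f`_m) ->
    all (fun z => vge B f.[z]) zs -> B <= b + n%:Z * tau.
Proof.
elim: n zs => [|n IH] [|z0 zs] //= [szs] /andP[z0d zsd] /andP[pz0 pz] f b B
  fn fnb hm /andP[fz0 fzs].
  (* For n = 0 the bounds on the higher coefficients make the constant term dominate, so the value
     at [z0] has valuation exactly b. *)
  have dom : vge (b + 1) (f.[z0] - f`_0).
    rewrite horner_coef; case sz : (size f) fn => [|k] fn.
      by move: fn; rewrite (nth_default) ?sz ?eqxx.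
    rewrite big_ord_recl expr0 mulr1 [f`_0 + _]addrC addrK; apply: vge_sum => i _.
    have e : b + 1 = (b + ((bump 0 i)%:Z - 0%:Z) * dl + 1) +
      (bump 0 i)%:Z * - dl by lia.
    by rewrite e; apply: vgeM; [apply: hm | apply: vgeX].
  have [ne vE] := vi_dominant fn (eq_rect_r (fun u => vge (u + 1) _) dom fnb).
  by move: fz0; rewrite addrC subrK in ne vE; rewrite vge_vi // vE; lia.
(* The first divided difference Q = (f - f(z0)) / (X - z0) satisfies the same hypotheses with n in
   place of n + 1. *)
have /factor_theorem [Q fE] : root (f - f.[z0]%:P) z0.
  by rewrite /root !hornerE subrr.
have coefQ m : Q`_m = f`_m.+1 + z0 * Q`_m.+1.
  have := congr1 (fun g : {poly L} => g`_m.+1) fE.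
  rewrite coefB coefC /= subr0 mulrBr coefB coefMX coefMC /= => ->; ring.
(* Descending induction on m, starting beyond the size of Q where the coefficients vanish. *)
have hQ m : (n < m)%N -> vge (b + (m%:Z - n%:Z) * dl + 1) Q`_m.
  have [k km] : exists k, (size Q - m <= k)%N by exists (size Q - m)%N.
  elim: k m km => [|k IHk] m km nm; first by rewrite nth_default ?vge0 -?subn_eq0 -?leqn0.
  rewrite coefQ vgeD //.
    by apply: vge_le (hm m.+1 _); lia.
  have e : b + (m%:Z - n%:Z) * dl + 1 = - dl + (b + (m.+1%:Z - n%:Z) * dl + 1)
    by lia.
  by rewrite e; apply: vgeM => //; apply: IHk; lia.
have [Qn Qnb] : Q`_n != 0 /\ vi Q`_n = b.
  rewrite coefQ -fnb; apply: vi_dominant => //; rewrite fnb.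
  have e : b + 1 = - dl + (b + (n.+1%:Z - n%:Z) * dl + 1) by lia.
  by rewrite e; apply: vgeM => //; apply: hQ.
(* Each difference z - z0 has valuation at most tau, so the values of Q at the remaining points have
   valuation at least B - tau. *)
suff : B - tau <= b + n%:Z * tau by lia.
apply: (IH zs szs zsd pz Q b _ Qn Qnb hQ).
apply/allP => z zz; have := allP pz0 _ zz; have := allP fzs _ zz => fz nz.
have dz : z - z0 != 0.
  by apply: contraNneq nz => zz0; rewrite -vgeN opprB zz0 vge0.
have QE : Q.[z] * (z - z0) = f.[z] - f.[z0].
  by have := congr1 (horner^~ z) fE; rewrite !hornerE => ->.
move: nz; rewrite -vgeN opprB vge_vi // => nz.
have : vge B (Q.[z] * (z - z0)) by rewrite QE vgeB.
have [->|Q0] := eqVneq Q.[z] 0; first by rewrite vge0.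
rewrite !vge_vi ?mulf_neq0 // viM //; move: nz.
by move: (vi Q.[z]) (vi (z - z0)) => u1 u2; clear; lia.
Qed.

End Valuations.

(** * Counting points at one place *)

Section SubgroupIndex.
Context {T : finZmodType}.

(** Subgroups of [T], phrased through differences to match the morphism hypotheses below. *)
Definition subtractive (H : {set T}) : Prop :=
  0 \in H /\ {in H &, forall x y, x - y \in H}.

(** Take X maximal among the subsets of H whose distinct points never differ by an element of P. By
    maximality H is covered by the translates of its P-part by the points of X, and there are at
    most n of these. *)
Lemma subtractive_card_le (H : {set T}) (P : pred T) (n : nat) :
  subtractive H -> P 0 -> (forall x, P (- x) = P x) ->
  (forall X : {set T}, X \subset H ->
     {in X &, forall x y, x != y -> ~~ P (x - y)} -> (#|X| <= n)%N) ->
  (#|H| <= n * #|[set z in H | P z]|)%N.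
Proof.
move=> [H0 Hsub] P0 PN hn.
pose ok (X : {set T}) := (X \subset H) &&
  [forall x in X, forall y in X, (x != y) ==> ~~ P (x - y)].
have ok0 : ok finset.set0.
  by rewrite /ok finset.sub0set; apply/forall_inP => x; rewrite finset.in_set0.
case: (arg_maxnP (fun X : {set T} => #|X|) ok0) => X /andP[XH /forall_inP Xp] Xmax.
have pX : {in X &, forall x y, x != y -> ~~ P (x - y)}.
  by move=> x y xX yX; have /forall_inP/(_ y yX)/implyP := Xp x xX.
apply: leq_trans (leq_mul (hn X XH pX) (leqnn _)).
have cover h : h \in H -> exists2 x, x \in X & P (h - x).
  move=> hH; apply: contrapT => nx.
  have nP x : x \in X -> ~~ P (h - x).
    by move=> xX; apply/negP => Px; apply: nx; exists x.
  have hX : h \notin X.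
    by apply/negP => hX; have := nP h hX; rewrite subrr P0.
  have : ok (h |: X).
    rewrite /ok finset.subUset finset.sub1set hH XH /=.
    apply/forall_inP => x /setU1P[->|xX]; apply/forall_inP => y /setU1P[->|yX];
      apply/implyP; rewrite ?eqxx // => xy.
    - exact: nP.
    - by rewrite -PN opprB nP.
    - exact: pX.
  by move=> /Xmax /=; rewrite cardsU1 hX add1n ltnn.
have sub : H \subset \bigcup_(x in X)
    [set x + z | z in [set z in H | P z]].
  apply/fintype.subsetP => h hH; have [x xX Px] := cover h hH.
  apply/bigcupP; exists x => //; apply/imsetP; exists (h - x).
    by rewrite inE Px andbT Hsub // (fintype.subsetP XH).
  by rewrite addrC subrK.
apply: leq_trans (subset_leq_card sub) _.
rewrite -sum_nat_const; elim/big_rec2: _ => [|x A B _ IH].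
  by rewrite cards0.
apply: leq_trans (leq_card_setU _ _) _.
by rewrite leq_add // leq_imset_card.
Qed.

End SubgroupIndex.

(** Arithmetic of the third stage of [local_pigeonhole], with D = q^r, E = q^(r-1) and n = q^i.
    After multiplication by qD, the terms in k - 1, d2 and d1 contribute less than C, at most C and
    at most qC against the main term -qDC, and qD >= q + 2. *)
Lemma stage_arith (q D E n k b C d1 d2 : int) :
  2 <= q -> D = q * E -> 0 < E -> 0 <= n -> n <= E -> 1 <= k ->
  D * D * (k - 1) < C -> b <= - C + n * d2 -> d2 * D <= d1 -> d1 * D <= C ->
  0 <= d1 -> 0 <= d2 -> 2 <= D -> 0 < C -> b + n * (k - 1) < - d1.
Proof.
move=> q2 DE E0 n0 nE k1 kC bC d2D d1D d10 d20 D2 C0.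
have e1 : n * (k - 1) <= E * (k - 1) by rewrite ler_wpM2r; lia.
have e2 : n * d2 <= E * d2 by rewrite ler_wpM2r; lia.
have e3 : q * D * (E * (k - 1)) < C.
  by have -> : q * D * (E * (k - 1)) = D * D * (k - 1) by rewrite DE; ring.
have e4 : q * D * (E * d2) <= C.
  have -> : q * D * (E * d2) = D * (d2 * D) by rewrite DE; ring.
  by apply: le_trans d1D; rewrite mulrC ler_wpM2r; lia.
have e5 : q * D * d1 <= q * C.
  have -> : q * D * d1 = q * (d1 * D) by ring.
  by rewrite ler_wpM2l; lia.
have e7 : (q + 2) * C <= q * D * C.
  rewrite ler_wpM2r //; first lia.
  have : q * 2 <= q * D by rewrite ler_wpM2l; lia.
  lia.
have qD0 : 0 < q * D by rewrite mulr_gt0; lia.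
rewrite -(ltr_pM2l qD0) mulrDr mulrN.
have e8 : q * D * b <= q * D * (- C + E * d2) by rewrite ler_wpM2l; lia.
have e9 : q * D * (n * (k - 1)) <= q * D * (E * (k - 1)) by rewrite ler_wpM2l; lia.
move: e8 e7 e3 e4 e5 e9; rewrite mulrDr mulrN mulrDl.
move: (q * D * b) (q * D * C) (q * D * (E * d2)) (q * D * (E * (k - 1)))
  (q * D * (n * (k - 1))) (q * D * d1) (q * C) => *.
lia.
Qed.

Section LocalPigeonhole.
Context {L : fieldType} (w : L -> \bar int) (hw : valuation w).
Context {T : finZmodType}.

Lemma subtractive_vge (H : {set T}) (u : T -> L) (k : int) :
  {morph u : x y / x - y} -> subtractive H ->
  subtractive [set z in H | vge w k (u z)].
Proof.
move=> uB [H0 HB]; split.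
  by rewrite inE H0 -(subrr 0) uB subrr vge0.
move=> x y; rewrite !inE => /andP[xH xk] /andP[yH yk].
by rewrite HB // uB vgeB.
Qed.

(** If more than n points of H had pairwise differences of valuation below k,
    [divided_difference_bound] with tau = k - 1 would give B <= b + n(k - 1). So
    [subtractive_card_le] applies. *)
Lemma vge_index (H : {set T}) (u : T -> L) (g : {poly L})
    (n : nat) (dl k b B : int) :
  {morph u : x y / x - y} -> subtractive H ->
  g`_n != 0 -> vi w g`_n = b ->
  (forall j, (n < j)%N -> vge w (b + (j%:Z - n%:Z) * dl + 1) g`_j) ->
  {in H, forall z, vge w (- dl) (u z)} ->
  {in H, forall z, vge w B g.[u z]} ->
  b + n%:Z * (k - 1) < B ->
  (#|H| <= n * #|[set z in H | vge w k (u z)]|)%N.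
Proof.
move=> uB Hs gn gb gj hd hB lt.
have u0 : u 0 = 0 by rewrite -(subrr 0) uB subrr.
have uN x : u (- x) = - u x by rewrite -sub0r uB u0 sub0r.
apply: subtractive_card_le => //; first by rewrite u0 vge0.
  by move=> x; rewrite uN vgeN.
move=> X XH pX; rewrite leqNgt; apply/negP => nX.
pose zs := [seq u z | z <- take n.+1 (enum X)].
have mem z : z \in take n.+1 (enum X) -> z \in X.
  by move=> /mem_take; rewrite mem_enum.
have szs : size zs = n.+1 by rewrite size_map size_takel // -cardE.
have zsd : all (vge w (- dl)) zs.
  by apply/allP => _ /mapP[z /mem/(fintype.subsetP XH)/hd h ->].
have zsB : all (fun z => vge w B g.[z]) zs.
  by apply/allP => _ /mapP[z /mem/(fintype.subsetP XH)/hB h ->].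
have pzs : pairwise (fun z z' => ~~ vge w (k - 1 + 1) (z - z')) zs.
  rewrite pairwise_map subrK.
  have : pairwise (fun x y : T => x != y) (take n.+1 (enum X)).
    by rewrite -uniq_pairwise take_uniq ?enum_uniq.
  apply: sub_in_pairwise (allss _) => x y /mem xX /mem yX xy /=.
  by rewrite -uB pX.
by have := divided_difference_bound hw szs zsd pzs gn gb gj zsB; lia.
Qed.

(** The additive polynomial in x attached to the twisted polynomial with coefficients [a i]; in this
    form phi_t can be interpolated. *)
Definition qlin (q r : nat) (a : nat -> L) : {poly L} :=
  \sum_(i < r.+1) a i *: 'X^(q ^ i).

Lemma coef_qlin (q r : nat) (a : nat -> L) (i : nat) :
  (1 < q)%N -> (i <= r)%N -> (qlin q r a)`_(q ^ i) = a i.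
Proof.
move=> q1 ir; rewrite coef_sum (bigD1 (Ordinal (ir : (i < r.+1)%N))) //=.
rewrite coefZ coefXn eqxx mulr1 big1 ?addr0 // => j ji.
rewrite coefZ coefXn eqn_exp2l // eq_sym; case: eqP => [e|]; last by rewrite mulr0.
by case/eqP: ji; apply: val_inj.
Qed.

Lemma coef_qlin_cases (q r : nat) (a : nat -> L) (j : nat) :
  (1 < q)%N -> (qlin q r a)`_j = 0 \/ exists2 i, (i <= r)%N & j = (q ^ i)%N.
Proof.
move=> q1; have [/existsP[i /eqP ->]|] := boolP [exists i : 'I_r.+1, j == (q ^ i)%N].
  by right; exists i => //; rewrite -ltnS.
rewrite negb_exists => /forallP h; left.
by rewrite coef_sum big1 // => i _; rewrite coefZ coefXn (negPf (h i)) mulr0.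
Qed.

(** Three uses of [vge_index]. Interpolation at the degree q^r of the leading coefficient 1 bounds
    F(u) from F(F(u)), then u from F(u), dividing the pole order by q^r each time. Interpolation at
    the degree q^i, i < r, of a dominant coefficient then turns the small pole of u into a zero.
    Each stage costs an index of at most q^r. *)
Lemma local_pigeonhole (q r : nat) (a : nat -> L) (C : int) (i0 : nat)
    (H : {set T}) (u : T -> L) :
  let F z := (qlin q r a).[z] in
  (1 < q)%N -> (0 < r)%N -> a r = 1 -> 0 < C ->
  (forall i, (i <= r)%N -> vge w (- C) (a i)) ->
  (i0 <= r)%N -> a i0 != 0 -> vi w (a i0) = - C ->
  {morph F : x y / x - y} ->
  {morph u : x y / x - y} -> subtractive H ->
  {in H, forall z, [/\ vge w (- C) (u z), vge w (- C) (F (u z)) &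
                       vge w (- C) (F (F (u z)))]} ->
  exists H' : {set T}, [/\ H' \subset H, subtractive H',
    (#|H| <= q ^ (3 * r) * #|H'|)%N &
    {in H', forall z, u z != 0 -> C <= (q ^ (2 * r))%:Z * vi w (u z)}].
Proof.
move=> F q1 r0 ar C0 aC i0r ai0 ai0C FB uB Hs HC.
pose D := (q ^ r)%N.
have D2 : (2 <= D)%N by rewrite (leq_trans q1) // -{1}(expn1 q) leq_exp2l.
have cD : (qlin q r a)`_D = 1 by rewrite coef_qlin.
have cDj j dl : (D < j)%N -> vge w (0 + (j%:Z - D%:Z) * dl + 1) (qlin q r a)`_j.
  move=> Dj; have [->|[i ir ji]] := coef_qlin_cases r a j q1.
    exact: vge0.
  by move: Dj; rewrite ji ltn_exp2l // ltnNge ir.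
have cD0 : (qlin q r a)`_D != 0 by rewrite cD oner_neq0.
have cDv : vi w (qlin q r a)`_D = 0 by rewrite cD vi1.
(* Pole orders allowed after the first and the second stage. *)
pose d1 := (C %/ D%:Z)%Z; pose d2 := (d1 %/ D%:Z)%Z.
have d1l : d1 * D%:Z <= C by apply: lez_floor; lia.
have d1u : C < (d1 + 1) * D%:Z by apply: ltz_ceil; lia.
have d2l : d2 * D%:Z <= d1 by apply: lez_floor; lia.
have d2u : d1 < (d2 + 1) * D%:Z by apply: ltz_ceil; lia.
have d10 : 0 <= d1 by nia.
have d20 : 0 <= d2 by nia.
(* First stage: the interpolation points are F(u z), the values F(F(u z)). *)
pose u1 z := F (u z).
have u1B : {morph u1 : x y / x - y} by move=> x y; rewrite /u1 uB FB.
pose H1 := [set z in H | vge w (- d1) (u1 z)].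
have H1s : subtractive H1 by apply: subtractive_vge.
have H1c : (#|H| <= D * #|H1|)%N.
  apply: (vge_index (g := qlin q r a) (dl := C) (b := 0) (B := - C)) => //.
  - by move=> j; apply: cDj.
  - by move=> z /HC[].
  - by move=> z /HC[].
  - nia.
(* Second stage: the points are u z, the values F(u z), now of pole order at most d1. *)
pose H2 := [set z in H1 | vge w (- d2) (u z)].
have H2s : subtractive H2 by apply: subtractive_vge.
have H2c : (#|H1| <= D * #|H2|)%N.
  apply: (vge_index (g := qlin q r a) (dl := C) (b := 0) (B := - d1)) => //.
  - by move=> j; apply: cDj.
  - by move=> z; rewrite inE => /andP[/HC[]].
  - by move=> z; rewrite inE => /andP[].
  - nia.
pose D' := (q ^ (2 * r))%N.
have D'E : D' = (D * D)%N by rewrite /D' mul2n -addnn expnD.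
(* The ceiling of C / q^(2r), written as a negated floor. *)
pose k := - ((- C) %/ D'%:Z)%Z.
have kl : C <= D'%:Z * k.
  have : ((- C) %/ D'%:Z)%Z * D'%:Z <= - C by apply: lez_floor; lia.
  by rewrite /k; lia.
have ku : D'%:Z * (k - 1) < C.
  have : - C < (((- C) %/ D'%:Z)%Z + 1) * D'%:Z by apply: ltz_ceil; lia.
  by rewrite /k; lia.
have k1 : 1 <= k by nia.
(* The exponent q^i at which |a_i| rho^(q^i) is largest, for log rho = d2; ties are
   broken in favour of the largest i by the perturbation of the key. *)
pose key (i : 'I_r.+1) : int :=
  (vi w (a i) - (q ^ i)%:Z * d2) * r.+1%:Z - i%:Z.
pose I0 := Ordinal (i0r : (i0 < r.+1)%N).
have [i ai imin] : exists2 i : 'I_r.+1, a i != 0 &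
    forall j : 'I_r.+1, a j != 0 -> key i <= key j.
  case: (@Order.TotalTheory.arg_minP _ int _ I0 (fun i => a i != 0) key ai0) => i ai im.
  by exists i.
have cmp (j : 'I_r.+1) : a j != 0 ->
    vi w (a i) - (q ^ i)%:Z * d2 <= vi w (a j) - (q ^ j)%:Z * d2 /\
    ((i < j)%N -> vi w (a i) - (q ^ i)%:Z * d2 < vi w (a j) - (q ^ j)%:Z * d2).
  move=> /imin; rewrite /key; have := ltn_ord i; have := ltn_ord j.
  set x := vi w (a i) - _; set y := vi w (a j) - _.
  move: x y (nat_of_ord i) (nat_of_ord j) => x y m n nr mr h; split=> [|mn].
    rewrite leNgt; apply/negP => xy.
    have : (y + 1) * r.+1%:Z <= x * r.+1%:Z by rewrite ler_wpM2r // lezD1.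
    lia.
  rewrite ltNge; apply/negP => xy.
  have : y * r.+1%:Z <= x * r.+1%:Z by rewrite ler_wpM2r.
  lia.
have [bi _] := cmp I0 ai0; rewrite /= ai0C in bi.
have q0 : (0 < q ^ i0)%N by rewrite expn_gt0 (ltn_trans _ q1).
(* For i = r, comparison with [i0] would give C <= q^r d2 <= d1, whereas 2 d1 <= C. *)
have ir : (i < r)%N.
  rewrite ltn_neqAle -ltnS ltn_ord andbT; apply/eqP => ier.
  move: bi; rewrite ier ar vi1 // -/D => bi.
  have : 0 <= (q ^ i0)%:Z * d2 by rewrite mulr_ge0.
  have : d1 * 2 <= d1 * D%:Z by rewrite ler_wpM2l.
  lia.
pose E := (q ^ r.-1)%N.
have DE : D = (q * E)%N by rewrite /D /E -expnS prednK.
have nE : (q ^ i <= E)%N by rewrite leq_exp2l // -ltnS prednK.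
have n1 : (0 < q ^ i)%N by rewrite expn_gt0 (ltn_trans _ q1).
(* Third stage: on [H2] the points have pole order at most d2, the values at most d1, and the term
   of degree q^i strictly dominates those of higher degree. *)
have H3c : (#|H2| <= q ^ i * #|[set z in H2 | vge w k (u z)]|)%N.
  apply: (vge_index (g := qlin q r a) (dl := d2) (b := vi w (a i)) (B := - d1)) => //.
  - by rewrite coef_qlin // ltnW.
  - by rewrite coef_qlin // ltnW.
  - move=> j ij; have [->|[i' i'r ji]] := coef_qlin_cases r a j q1.
      exact: vge0.
    rewrite ji coef_qlin //; have [->|ai'] := eqVneq (a i') 0; first exact: vge0.
    have [_ /(_ _)] := cmp (Ordinal (i'r : (i' < r.+1)%N)) ai'.
    move: ij; rewrite ji ltn_exp2l // => ii' /(_ ii') /=.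
    by rewrite vge_vi //; move: (vi w (a i)) (vi w (a i')) => *; lia.
  - by move=> z; rewrite inE => /andP[].
  - by move=> z; rewrite !inE => /andP[/andP[]].
  - apply: (@stage_arith q%:Z D%:Z E%:Z (q ^ i)%:Z k _ C d1 d2) => //.
    + by rewrite DE PoszM.
    + by rewrite ltz_nat expn_gt0 (ltn_trans _ q1).
    + by rewrite -PoszM -D'E.
    + move: bi; move: (vi w (a i)) => b bi.
      have : 0 <= (q ^ i0)%:Z * d2 by rewrite mulr_ge0.
      lia.
exists [set z in H2 | vge w k (u z)]; split.
- by apply/fintype.subsetP => z; rewrite !inE => /andP[/andP[/andP[]]].
- exact: subtractive_vge.
- have -> : (q ^ (3 * r) = D * (D * D))%N by rewrite -!expnD; congr (_ ^ _)%N; lia.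
  apply: leq_trans H1c _; rewrite -!mulnA leq_mul2l; apply/orP; right.
  apply: leq_trans H2c _; rewrite leq_mul2l; apply/orP; right.
  by apply: leq_trans H3c _; rewrite leq_mul2r leq_exp2l // (ltnW ir) orbT.
- move=> z; rewrite inE => /andP[_] + uz; rewrite vge_vi // => kz.
  by apply: le_trans kl _; rewrite -/D' ler_wpM2l.
Qed.

End LocalPigeonhole.

(** * Twisted polynomials *)

Section TwistedPolynomials.
Variables (p m q : nat).
Hypotheses (hp : prime p) (hm : (0 < m)%N) (hq : q = (p ^ m)%N).

Lemma q_gt1 : (1 < q)%N.
Proof. by rewrite hq -(expn0 p) ltn_exp2l // prime_gt1. Qed.

Lemma pchar_nat_qX (E : fieldType) (l : nat) :
  p \in [pchar E] -> [pchar E].-nat (q ^ l)%N.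
Proof.
by move=> hE; rewrite hq -expnM pnatX (eq_pnat _ (pcharf_eq hE)) pnat_id.
Qed.

Section FrobeniusPower.
Context {E : fieldType} (hE : p \in [pchar E]) (l : nat).

Lemma qexpD : {morph (fun x : E => x ^+ (q ^ l)) : x y / x + y}.
Proof. by move=> x y; rewrite exprDn_pchar // pchar_nat_qX. Qed.

Lemma qexp0 : (0 : E) ^+ (q ^ l) = 0.
Proof. by rewrite expr0n expn_eq0 gtn_eqF // (ltn_trans _ q_gt1). Qed.

Lemma qexp_sum (I : Type) (s : seq I) (P : pred I) (f : I -> E) :
  (\sum_(i <- s | P i) f i) ^+ (q ^ l) = \sum_(i <- s | P i) f i ^+ (q ^ l).
Proof. exact: (big_morph _ qexpD qexp0). Qed.

End FrobeniusPower.

Section Evaluation.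
Context {K E : fieldType} (h : {rmorphism K -> E}).

Lemma tevalE (f : {poly K}) (x : E) (n : nat) : (size f <= n)%N ->
  teval q h f x = \sum_(l < n) h f`_l * x ^+ (q ^ l).
Proof.
move=> fn; rewrite /teval /xpoly rmorph_sum horner_sum.
rewrite (eq_bigr (fun i : 'I_(size f) => h f`_i * x ^+ (q ^ i))); last first.
  by move=> i _; rewrite /= map_polyZ map_polyXn hornerZ hornerXn.
rewrite (big_ord_widen n (fun l => h f`_l * x ^+ (q ^ l)) fn).
rewrite [RHS](bigID (fun i : 'I_n => (i < size f)%N)) /= [X in _ = _ + X]big1 ?addr0 //.
by move=> i; rewrite -leqNgt => fi; rewrite nth_default // rmorph0 mul0r.
Qed.

Lemma tevalDl (f g : {poly K}) (x : E) :
  teval q h (f + g) x = teval q h f x + teval q h g x.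
Proof.
pose n := maxn (size f) (size g).
rewrite !(@tevalE _ _ n) ?leq_maxl ?leq_maxr ?size_polyD // -big_split /=.
by apply: eq_bigr => i _; rewrite coefD rmorphD mulrDl.
Qed.

Lemma tevalC (c : K) (x : E) : teval q h c%:P x = h c * x.
Proof. by rewrite (@tevalE _ _ 1) ?size_polyC_leq1 // big_ord1 coefC expn0. Qed.

Lemma teval_qlin (f : {poly K}) (x : E) (r : nat) : (size f <= r.+1)%N ->
  teval q h f x = (qlin q r (fun l => h f`_l)).[x].
Proof.
move=> fr; rewrite (tevalE _ fr) horner_sum; apply: eq_bigr => i _.
by rewrite hornerZ hornerXn.
Qed.

Hypothesis hE : p \in [pchar E].

Lemma tevalDr (f : {poly K}) : {morph teval q h f : x y / x + y}.
Proof.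
move=> x y; rewrite !(@tevalE _ _ (size f)) // -big_split /=.
by apply: eq_bigr => i _; rewrite qexpD // mulrDr.
Qed.

Lemma tevalBr (f : {poly K}) : {morph teval q h f : x y / x - y}.
Proof.
by move=> x y; apply: (addIr (teval q h f y)); rewrite -tevalDr !subrK.
Qed.

Lemma teval_tmul (f g : {poly K}) (x : E) :
  teval q h (tmul q f g) x = teval q h f (teval q h g x).
Proof.
have teval_sum (I : Type) (s : seq I) (F : I -> {poly K}) :
    teval q h (\sum_(i <- s) F i) x = \sum_(i <- s) teval q h (F i) x.
  apply: (big_morph (fun f => teval q h f x)) => [u v|]; first exact: tevalDl.
  by rewrite -polyC0 tevalC rmorph0 mul0r.
rewrite /tmul teval_sum (tevalE _ (leqnn (size f))); apply: eq_bigr => i _.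
rewrite teval_sum (tevalE _ (leqnn (size g))) qexp_sum // mulr_sumr.
apply: eq_bigr => j _.
rewrite (@tevalE _ _ (i + j).+1); last first.
  by apply: leq_trans (size_scale_leq _ _) _; rewrite size_polyXn.
rewrite big_ord_recr /= big1 ?add0r => [|l _].
  rewrite coefZ coefXn eqxx mulr1 rmorphM rmorphXn exprMn -exprM -expnD.
  by rewrite mulrA [(j + i)%N]addnC.
by rewrite coefZ coefXn ltn_eqF // mulr0 rmorph0 mul0r.
Qed.

End Evaluation.

(** * Degrees of twisted polynomials *)

Section Degrees.
Context {K : fieldType}.

Lemma coef_tmul (f g : {poly K}) (k : nat) :
  (tmul q f g)`_k = \sum_(i < k.+1) f`_i * g`_(k - i) ^+ (q ^ i).
Proof.
rewrite /tmul coef_sum.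
have step (i : nat) : (\sum_(j < size g) (f`_i * g`_j ^+ (q ^ i)) *: 'X^(i + j))`_k
    = if (i <= k)%N then f`_i * g`_(k - i) ^+ (q ^ i) else 0.
  rewrite coef_sum; case: leqP => ik; last first.
    by rewrite big1 // => j _; rewrite coefZ coefXn ltn_eqF ?mulr0 // ltn_addr.
  have [gj|gj] := ltnP (k - i) (size g); last first.
    rewrite [in RHS](nth_default _ gj) qexp0 mulr0 big1 // => j _.
    by rewrite coefZ coefXn gtn_eqF ?mulr0 //; have := ltn_ord j; lia.
  rewrite (bigD1 (Ordinal gj)) //= coefZ coefXn subnKC // eqxx mulr1 big1 ?addr0 //.
  move=> j jk; rewrite coefZ coefXn; case: eqP => [e|]; last by rewrite mulr0.
  by case/eqP: jk; apply: val_inj => /=; lia.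
under eq_bigr do rewrite step.
pose G i := if (i <= k)%N then f`_i * g`_(k - i) ^+ (q ^ i) else 0.
pose n := maxn (size f) k.+1.
transitivity (\sum_(i < n) G i).
  rewrite (big_ord_widen n G) ?leq_maxl //.
  rewrite [RHS](bigID (fun i : 'I_n => (i < size f)%N)) /= [X in _ = _ + X]big1 ?addr0 //.
  by move=> i; rewrite -leqNgt => fi; rewrite /G nth_default // mul0r if_same.
rewrite [RHS](eq_bigr (fun i : 'I_k.+1 => G i)); last first.
  by move=> i _; rewrite /G -ltnS ltn_ord.
rewrite [RHS](big_ord_widen n G) ?leq_maxr //.
rewrite [LHS](bigID (fun i : 'I_n => (i < k.+1)%N)) /= [X in _ + X]big1 ?addr0 //.
by move=> i; rewrite /G ltnS => /negPf ->.
Qed.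

Lemma size_tmul_leq (f g : {poly K}) : (size (tmul q f g) <= (size f + size g).-1)%N.
Proof.
apply/leq_sizeP => k fgk; rewrite coef_tmul big1 // => i _.
have [fi|fi] := ltnP i (size f); last by rewrite nth_default // mul0r.
rewrite [g`__]nth_default ?qexp0 ?mulr0 //.
have := ltn_ord i; move: fgk fi; move: (size f) (size g) (nat_of_ord i) => *; lia.
Qed.

(** In top degree only the two leading terms meet, and moving tau^(deg f) past the leading
    coefficient of [g] raises it to the power q^(deg f). *)
Lemma coef_tmul_top (f g : {poly K}) : f != 0 -> g != 0 ->
  (tmul q f g)`_((size f).-1 + (size g).-1) =
  lead_coef f * lead_coef g ^+ (q ^ (size f).-1).
Proof.
rewrite -!size_poly_gt0 => f0 g0; rewrite coef_tmul.
have lt : ((size f).-1 < ((size f).-1 + (size g).-1).+1)%N by rewrite ltnS leq_addr.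
rewrite (bigD1 (Ordinal lt)) //= [X in _ + X]big1 ?addr0 => [|i ine].
  by rewrite addKn !lead_coefE.
have [fi|fi] := ltnP i (size f); last by rewrite nth_default // mul0r.
have ine' : i != (size f).-1 :> nat by [].
rewrite [g`__]nth_default ?qexp0 ?mulr0 //.
move: f0 g0 fi ine'; move: (size f) (size g) (nat_of_ord i) => *; lia.
Qed.

Lemma tmul_neq0 (f g : {poly K}) : f != 0 -> g != 0 -> tmul q f g != 0.
Proof.
move=> f0 g0; apply/negP => /eqP fg0.
have /eqP := coef_tmul_top f0 g0; rewrite fg0 coef0 eq_sym mulf_eq0.
by rewrite lead_coef_eq0 (negPf f0) expf_eq0 lead_coef_eq0 (negPf g0) andbF.
Qed.

Lemma size_tmul (f g : {poly K}) : f != 0 -> g != 0 ->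
  (size (tmul q f g)).-1 = ((size f).-1 + (size g).-1)%N.
Proof.
move=> f0 g0; apply/eqP; rewrite eqn_leq; apply/andP; split.
  have := size_tmul_leq f g; rewrite -!size_poly_gt0 in f0 g0; lia.
rewrite -ltnS prednK ?size_poly_gt0 ?tmul_neq0 // ltnNge.
apply/negP => /leq_sizeP/(_ _ (leqnn _))/eqP.
rewrite coef_tmul_top // mulf_eq0 expf_eq0 !lead_coef_eq0.
by rewrite (negPf f0) (negPf g0) andbF.
Qed.

Lemma xdegE (f : {poly K}) : f != 0 -> xdeg q f = (q ^ (size f).-1)%N.
Proof.
move=> f0; rewrite /xdeg /xpoly.
have e : size f = (size f).-1.+1 by rewrite prednK ?size_poly_gt0.
rewrite [in \sum_(_ < _) _]e big_ord_recr /= addrC size_polyDl.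
  by rewrite size_scale ?size_polyXn // -lead_coefE lead_coef_eq0.
rewrite size_scale ?size_polyXn -?lead_coefE ?lead_coef_eq0 //.
rewrite ltnS; apply: leq_trans (size_sum _ _ _) _; apply/bigmax_leqP => i _.
apply: leq_trans (size_scale_leq _ _) _.
by rewrite size_polyXn ltn_exp2l ?q_gt1.
Qed.

End Degrees.

End TwistedPolynomials.

(** * Tate's limit *)

(** Dividing by Q^(n+1) shows that v changes by at most C/Q^(n+1) at step n, which is at most the
    decrease of C/Q^n because Q >= 2. So v - C/Q^n increases and v + C/Q^n decreases, starting at u
    0 - C and u 0 + C. *)
Lemma tate_limit (R : realType) (u : nat -> R) (Q C : R) :
  2 <= Q -> (forall n, `|u n.+1 - Q * u n| <= C) ->
  let v := (fun n => u n / Q ^+ n) : R^nat in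
  cvgn v /\ `|limn v - u 0%N| <= C.
Proof.
move=> Q2 hu v.
have C0 : 0 <= C by apply: le_trans (hu 0%N).
have Q0 : 0 < Q by lra.
have Qn n : 0 < Q ^+ n by rewrite exprn_gt0.
have step n : `|v n.+1 - v n| <= C / Q ^+ n.+1.
  have -> : v n.+1 - v n = (u n.+1 - Q * u n) / Q ^+ n.+1.
    by rewrite /v exprS; field; rewrite !gt_eqF.
  by rewrite normrM normfV (gtr0_norm (Qn _)) ler_pM2r ?invr_gt0.
have geo n : C / Q ^+ n.+1 <= C / Q ^+ n - C / Q ^+ n.+1.
  rewrite lerBrDr -mulr2n -mulr_natl exprS invfM.
  have -> : 2%:R * (C * (Q^-1 * (Q ^+ n)^-1)) = (2%:R / Q) * (C / Q ^+ n) by ring.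
  apply: ler_piMl; first by rewrite divr_ge0 // ltW.
  by rewrite ler_pdivrMr // mul1r.
pose lo : R^nat := fun n => v n - C / Q ^+ n.
pose hi : R^nat := fun n => v n + C / Q ^+ n.
have lo_nd : nondecreasing_seq lo.
  apply/nondecreasing_seqP => n; rewrite /lo.
  by have := step n; have := geo n; rewrite ler_norml => ? /andP[? ?]; lra.
have hi_ni : nonincreasing_seq hi.
  apply/nonincreasing_seqP => n; rewrite /hi.
  by have := step n; have := geo n; rewrite ler_norml => ? /andP[? ?]; lra.
have v0 : v 0%N = u 0%N by rewrite /v expr0 divr1.
have pos n : 0 <= C / Q ^+ n by rewrite divr_ge0 // ltW.
have hi0 n : v n <= u 0%N + C.
  have := hi_ni 0%N n (leq0n n); rewrite /hi v0 expr0 divr1.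
  by have := pos n; lra.
have lo0 n : u 0%N - C <= v n.
  have := lo_nd 0%N n (leq0n n); rewrite /lo v0 expr0 divr1.
  by have := pos n; lra.
have lo_cv : cvgn lo.
  apply: nondecreasing_is_cvgn => //; exists (u 0%N + C) => _ [n _ <-].
  by have := hi0 n; have := pos n; rewrite /lo; lra.
have g0 : ((fun n => C / Q ^+ n : R) @ \oo --> (0 : R))%classic.
  have -> : (fun n => C / Q ^+ n : R) = geometric C Q^-1.
    by apply/funext => n; rewrite /geometric /= exprVn.
  apply: cvg_geometric; rewrite gtr0_norm ?invr_gt0 // invf_lt1 //; lra.
have vE : v = lo \+ (fun n => C / Q ^+ n).
  by apply/funext => n; rewrite /lo /= subrK.
have v_cv : cvgn v.
  by rewrite vE; apply: is_cvgD => //; apply/cvg_ex; exists 0.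
split=> //; rewrite ler_norml; apply/andP; split.
  rewrite lerBrDl; apply: limr_ge => //; near=> n; exact: lo0.
rewrite lerBlDl; apply: limr_le => //; near=> n; exact: hi0.
Unshelve. all: by end_near. Qed.

(** * Polar parts under a twisted polynomial *)

Section TruncatedValuation.
Context {E : fieldType} (w : E -> \bar int) (hw : valuation w).

(** The polar part of z, whose growth defines the local height. For a valuation the minimum is
    finite even at z = 0. *)
Definition vmin0 (z : E) : int := fine (mine 0%E (w z)).

Lemma vmin0_0 : vmin0 0 = 0.
Proof. by rewrite /vmin0 (val_zero hw) min_l ?leey. Qed.

Lemma vmin0E (z : E) : z != 0 -> vmin0 z = Num.min 0 (vi w z).
Proof. by move=> z0; rewrite /vmin0 (val_vi hw z0) -EFin_min. Qed.

Lemma vmin0_le0 (z : E) : vmin0 z <= 0.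
Proof.
have [->|z0] := eqVneq z 0; first by rewrite vmin0_0.
by rewrite vmin0E // ge_min lexx.
Qed.

Lemma vmin0_vge (k : int) (z : E) : k <= 0 -> vge w k z -> k <= vmin0 z.
Proof.
have [->|z0] := eqVneq z 0; first by rewrite vmin0_0.
by rewrite vge_vi // vmin0E // le_min => -> ->.
Qed.

Section TwistedEvaluation.
Variables (p m q : nat).
Hypotheses (hp : prime p) (hm : (0 < m)%N) (hq : q = (p ^ m)%N).
Context {K : fieldType} (h : {rmorphism K -> E}).
Variables (f : {poly K}) (c : int).
Hypotheses (f0 : f != 0) (lf : vi w (h (lead_coef f)) = 0) (c0 : 0 <= c).
Hypothesis hc : forall l, vge w (- c) (h f`_l).

Let d := (size f).-1.

(** For i < d one has q^d v(z) <= (q^i + 1) v(z) < q^i v(z) - c, so the leading term, whose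
    coefficient is a unit, dominates all others. *)
Lemma teval_large (z : E) : z != 0 -> vi w z < - c ->
  teval q h f z != 0 /\ vi w (teval q h f z) = (q ^ d)%:Z * vi w z.
Proof.
move=> z0 zc.
have q1 := q_gt1 hp hm hq.
have sf : size f = d.+1 by rewrite /d prednK ?size_poly_gt0.
have l0 : h (lead_coef f) * z ^+ (q ^ d) != 0.
  by rewrite mulf_neq0 ?expf_neq0 // fmorph_eq0 lead_coef_eq0.
have lv : vi w (h (lead_coef f) * z ^+ (q ^ d)) = (q ^ d)%:Z * vi w z.
  by rewrite viM ?expf_neq0 ?fmorph_eq0 ?lead_coef_eq0 // viX // lf add0r.
rewrite (@tevalE q _ _ h f z d.+1) ?sf // big_ord_recr /= addrC -/d.
rewrite {1 2}[f`_d]lead_coefE -/d in l0 lv *.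
rewrite -lv; apply: (vi_dominant hw) => //; rewrite lv; apply: (vge_sum hw) => i _.
apply: (@vge_le _ _ _ (- c + (q ^ i)%:Z * vi w z)); last first.
  apply: (vgeM hw) => //; rewrite vge_vi ?expf_neq0 // (viX hw) //.
have : (q ^ i).+1%:Z * vi w z >= (q ^ d)%:Z * vi w z.
  by rewrite ler_wnM2r ?lez_nat ?ltn_exp2l //; lia.
by rewrite -addn1 PoszD mulrDl mul1r; lia.
Qed.

(** A pole deeper than c is multiplied exactly by q^d. Otherwise both terms of the difference lie
    between -(1 + q^d)c and 0. *)
Lemma vmin0_teval (z : E) :
  `|vmin0 (teval q h f z) - (q ^ d)%:Z * vmin0 z| <= (1 + (q ^ d)%:Z) * c.
Proof.
have q1 := q_gt1 hp hm hq.
have sf : size f = d.+1 by rewrite /d prednK ?size_poly_gt0.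
have qd0 : (0 < (q ^ d)%:Z) by rewrite ltz_nat expn_gt0 (ltn_trans _ q1).
have large : z != 0 -> vi w z < - c -> `|vmin0 (teval q h f z) - (q ^ d)%:Z * vmin0 z| = 0.
  move=> z0 zc; have [n0 vE] := teval_large z0 zc.
  rewrite !vmin0E // vE !min_r ?subrr ?normr0 //; first by lia.
  by rewrite mulr_ge0_le0 //; lia.
have bd0 : 0 <= (1 + (q ^ d)%:Z) * c by rewrite mulr_ge0; lia.
have small : vge w (- c) z -> `|vmin0 (teval q h f z) - (q ^ d)%:Z * vmin0 z|
    <= (1 + (q ^ d)%:Z) * c.
  move=> zc; have mz : - c <= vmin0 z by apply: vmin0_vge => //; lia.
  have mf : - ((1 + (q ^ d)%:Z) * c) <= vmin0 (teval q h f z).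
    apply: vmin0_vge; first lia.
    rewrite (@tevalE q _ _ h f z d.+1) ?sf //; apply: (vge_sum hw) => i _.
    apply: (@vge_le _ _ _ (- c + (q ^ i)%:Z * - c)); last first.
      by apply: (vgeM hw) => //; apply: (vgeX hw).
    have : (q ^ i)%:Z * c <= (q ^ d)%:Z * c.
      by rewrite ler_wpM2r // lez_nat leq_exp2l // -ltnS.
    lia.
  have mf0 := vmin0_le0 (teval q h f z); have mz0 := vmin0_le0 z.
  have b1 : (q ^ d)%:Z * vmin0 z <= 0 by rewrite mulr_ge0_le0 // ltW.
  have b2 : (q ^ d)%:Z * - c <= (q ^ d)%:Z * vmin0 z by rewrite ler_wpM2l // ltW.
  rewrite ler_norml; apply/andP; split; lia.
have [z0|z0] := eqVneq z 0; first by apply: small; rewrite z0 vge0.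
have [zc|zc] := ltP (vi w z) (- c); first by rewrite large.
by apply: small; rewrite vge_vi.
Qed.

End TwistedEvaluation.

Lemma vge_coef_bound {K : fieldType} (h : {rmorphism K -> E}) (f : {poly K}) :
  exists2 c : int, 0 <= c & forall l, vge w (- c) (h f`_l).
Proof.
exists (\sum_(l < size f) `|vi w (h f`_l)|); first by apply: sumr_ge0.
move=> l; have [lf|lf] := ltnP l (size f); last first.
  by rewrite nth_default // rmorph0 vge0.
rewrite /vge (bigD1 (Ordinal lf)) //=; apply/orP; right.
have : 0 <= \sum_(i < size f | i != Ordinal lf) `|vi w (h f`_i)| by apply: sumr_ge0.
move: (\sum_(_ < _ | _) _) (vi w (h f`_l)) => S k; lia.
Qed.

End TruncatedValuation.

(** * Drinfeld modules and local heights *)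

Section DrinfeldModules.
Variables (p m q : nat).
Hypotheses (hp : prime p) (hm : (0 < m)%N) (hq : q = (p ^ m)%N).
Context {A : comNzRingType} {K : fieldType} (hK : p \in [pchar K]).
Context {i : {rmorphism A -> K}} (phi : A -> {poly K}).
Hypothesis hphi : drinfeld_module q i phi.

Definition tdeg (b : A) : nat := (size (phi b)).-1.

Lemma drin_0 : phi 0 = 0.
Proof. by apply: (addIr (phi 0)); rewrite -(drin_add hphi) !add0r. Qed.

Lemma drin_X (b : A) (n : nat) : phi b != 0 ->
  phi (b ^+ n) != 0 /\ tdeg (b ^+ n) = (n * tdeg b)%N.
Proof.
move=> b0; elim: n => [|n [IH0 IHd]].
  by rewrite expr0 /tdeg (drin_one hphi) oner_neq0 size_poly1.
rewrite exprS /tdeg (drin_mul hphi); split; first exact: (tmul_neq0 hp hm hq).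
by rewrite (size_tmul hp hm hq) // mulSn -IHd.
Qed.

Lemma tdeg_mul_le (a b : A) : (tdeg (a * b) <= tdeg a + tdeg b)%N.
Proof.
rewrite /tdeg (drin_mul hphi).
have [->|a0] := eqVneq (phi a) 0; last first.
  have [->|b0] := eqVneq (phi b) 0; last by rewrite (size_tmul hp hm hq).
  rewrite /tmul size_poly0 big1 ?size_poly0 // => l _; by rewrite big_ord0.
by rewrite /tmul size_poly0 big_ord0 size_poly0.
Qed.

Lemma tdeg_add_le (n : nat) (a b : A) :
  (tdeg a <= n)%N -> (tdeg b <= n)%N -> (tdeg (a + b) <= n)%N.
Proof.
rewrite /tdeg (drin_add hphi) => an bn; clear -an bn.
have := size_polyD (phi a) (phi b); rewrite /maxn; case: ifP => _; lia.
Qed.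

Section Action.
Context {E : fieldType} (h : {rmorphism K -> E}) (hE : p \in [pchar E]).

Definition action (b : A) (y : E) : E := teval q h (phi b) y.

Lemma actionDl (a b : A) (y : E) : action (a + b) y = action a y + action b y.
Proof. by rewrite /action (drin_add hphi) (tevalDl _ _ _ _). Qed.

Lemma actionM (a b : A) (y : E) : action (a * b) y = action a (action b y).
Proof. by rewrite /action (drin_mul hphi) (teval_tmul hp hm hq). Qed.

Lemma action1 (y : E) : action 1 y = y.
Proof. by rewrite /action (drin_one hphi) -polyC1 tevalC rmorph1 mul1r. Qed.

Lemma action0 (y : E) : action 0 y = 0.
Proof. by apply: (addIr (action 0 y)); rewrite -actionDl !add0r. Qed.

Lemma actionBl (a b : A) (y : E) : action (a - b) y = action a y - action b y.
Proof. by apply: (addIr (action b y)); rewrite -actionDl !subrK. Qed.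

Lemma actionBr (b : A) : {morph action b : x y / x - y}.
Proof. by move=> x y; rewrite /action (tevalBr hp hq). Qed.

Lemma actionXS (b : A) (n : nat) (y : E) :
  action (b ^+ n.+1) y = action b (action (b ^+ n) y).
Proof. by rewrite exprS actionM. Qed.

Lemma actionC (a b : A) (y : E) : action a (action b y) = action b (action a y).
Proof. by rewrite -!actionM mulrC. Qed.

End Action.

Hypothesis phi_inj : forall b, b != 0 -> phi b != 0.
Variables (t : A) (r : nat).
Hypotheses (r_gt0 : (0 < r)%N) (sizet : size (phi t) = r.+1).
Hypothesis leadt : lead_coef (phi t) = 1.

Lemma phit_neq0 : phi t != 0.
Proof. by rewrite -size_poly_gt0 sizet. Qed.

Lemma tdegt : tdeg t = r.
Proof. by rewrite /tdeg sizet. Qed.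

(* The leading coefficients of [phi b * phi t = phi t * phi b]. *)
Lemma lead_coef_fixed (b : A) : b != 0 ->
  lead_coef (phi b) ^+ (q ^ r) = lead_coef (phi b).
Proof.
move=> /phi_inj b0.
have := coef_tmul_top hp hm hq b0 phit_neq0.
rewrite -(drin_mul hphi) mulrC (drin_mul hphi) addnC.
rewrite (coef_tmul_top hp hm hq phit_neq0 b0) leadt sizet /=.
by rewrite mul1r expr1n mulr1.
Qed.

(** By [lead_coef_fixed], this valuation is unchanged under multiplication by q^r >= 2. *)
Lemma vi_lead_coef {E : fieldType} (w : E -> \bar int) (hw : valuation w)
  (h : {rmorphism K -> E}) (b : A) : b != 0 -> vi w (h (lead_coef (phi b))) = 0.
Proof.
move=> b0; have l0 : h (lead_coef (phi b)) != 0.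
  by rewrite fmorph_eq0 lead_coef_eq0 phi_inj.
have := congr1 (fun x => vi w (h x)) (lead_coef_fixed b0).
rewrite rmorphXn /= (viX hw) //; move: (vi w _) => k.
have : (2 <= q ^ r)%N.
  by rewrite (leq_trans (q_gt1 hp hm hq)) // -{1}(expn1 q) leq_exp2l ?(q_gt1 hp hm hq).
by move=> q2 kE; nia.
Qed.

(** Let mu < 0 be the least valuation of a coefficient of phi_b, attained at j, and compare
    coefficients of degree r + j in phi_t phi_b = phi_b phi_t. The term from the leading 1 of phi_t
    has valuation q^r mu. All others are larger: at least q^k mu with k < r on its own side, at
    least mu on the other. *)
Lemma coef_integral {v : K -> \bar int} (hv : valuation v) (b : A) :
  (forall l, vge v 0 (phi t)`_l) -> forall l, vge v 0 (phi b)`_l.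
Proof.
move=> ht l; apply: contrapT => nl.
pose P (j : 'I_(size (phi b))) := ~~ vge v 0 (phi b)`_j.
have ls : (l < size (phi b))%N.
  by rewrite ltnNge; apply/negP => /(nth_default 0) h; apply: nl; rewrite h vge0.
have P0 : P (Ordinal ls) by apply/negP.
have [j Pj jmin] : exists2 j : 'I_(size (phi b)), P j &
    forall j' : 'I_(size (phi b)), P j' -> vi v (phi b)`_j <= vi v (phi b)`_j'.
  case: (@Order.TotalTheory.arg_minP _ int _ (Ordinal ls) P
    (fun j => vi v (phi b)`_j) P0) => j Pj jm.
  by exists j.
have bj0 : (phi b)`_j != 0 by apply: contraNneq Pj => ->; apply: vge0.
set mu := vi v (phi b)`_j in jmin.
have mu0 : mu < 0 by move: Pj; rewrite /P vge_vi // -ltNge.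
have bmu n : vge v mu (phi b)`_n.
  have [ns|ns] := ltnP n (size (phi b)); last by rewrite nth_default ?vge0.
  have [nP|nP] := boolP (vge v 0 (phi b)`_n); first by apply: vge_le nP; lia.
  by rewrite /vge (jmin (Ordinal ns)) ?orbT.
have q1 := q_gt1 hp hm hq.
have := congr1 (fun a => (phi a)`_(r + j)) (mulrC t b).
rewrite !(drin_mul hphi) !(coef_tmul hp hm hq).
have ltr : (r < (r + j).+1)%N by rewrite ltnS leq_addr.
rewrite (bigD1 (Ordinal ltr)) //= addKn.
have -> : (phi t)`_r = 1 by rewrite -leadt lead_coefE sizet.
rewrite mul1r => e.
have qmu k : (k < r)%N -> (q ^ r)%:Z * mu + 1 <= (q ^ k)%:Z * mu.
  move=> kr; have : (q ^ r)%:Z * mu <= ((q ^ k).+1)%:Z * mu.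
    by rewrite ler_wnM2r ?lez_nat ?ltn_exp2l // ltW.
  by rewrite -addn1 PoszD mulrDl mul1r; lia.
have qmur : (q ^ r)%:Z * mu + 1 <= mu.
  by have := qmu 0%N r_gt0; rewrite expn0 mul1r.
have vm : vi v ((phi b)`_j ^+ (q ^ r)) = (q ^ r)%:Z * mu by rewrite (viX hv).
have : vge v ((q ^ r)%:Z * mu + 1) ((phi b)`_j ^+ (q ^ r)).
  rewrite -[X in vge v _ X](addrK (\sum_(k < (r + j).+1 | k != Ordinal ltr)
    (phi t)`_k * (phi b)`_(r + j - k) ^+ (q ^ k))) e.
  apply: (vgeB hv); apply: (vge_sum hv) => k kr.
    apply: vge_le qmur _; rewrite -[mu]addr0; apply: (vgeM hv) => //.
    by rewrite -(mulr0 (q ^ k)%:Z); apply: (vgeX hv).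
  have [kr'|kr'] := ltnP k r.
    apply: vge_le (qmu _ kr') _; rewrite -[_ * mu]add0r; apply: (vgeM hv) => //.
    exact: (vgeX hv).
  rewrite nth_default ?mul0r ?vge0 // sizet ltn_neqAle kr' andbT.
  by apply: contraNneq kr => rk; apply/eqP/val_inj.
by rewrite vge_vi ?expf_neq0 // vm; lia.
Qed.

(** A condition on all of [A] is read off from phi_t: leading coefficients are units by
    [vi_lead_coef], and integrality spreads from phi_t to every phi_b by [coef_integral]. *)
Lemma bad_reductionP (v : K -> \bar int) : valuation v ->
  bad_reduction phi v <-> exists l, ~~ vge v 0 (phi t)`_l.
Proof.
move=> hv; split.
  move=> [b b0 bad]; apply: contrapT => nl.
  have int l : vge v 0 (phi t)`_l by apply: contrapT => /negP nv; apply: nl; exists l.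
  case: bad => [[l]|]; last first.
    rewrite (val_vi hv) ?lead_coef_eq0 ?phi_inj // => /eqP; apply.
    by have /= -> := vi_lead_coef hv idfun b0.
  by rewrite ltNge -(vgeE hv) (coef_integral hv b int).
move=> [l]; rewrite (vgeE hv) -ltNge => bad.
by exists t; [apply: contraTneq phit_neq0 => ->; rewrite drin_0 eqxx | left; exists l].
Qed.

(** * Local heights as limits *)

Section LocalHeights.
Context {R : realType} {E : fieldType} (h : {rmorphism K -> E}).
Context (w : E -> \bar int) (hw : valuation w).
Variables (a : A) (a_gt0 : (0 < tdeg a)%N).

(** The limit in [local_height] without the factor -d(w), over an arbitrary field containing [K]. *)
Definition local_limit (y : E) : R :=
  limn (fun n => (vmin0 w (action h (a ^+ n) y))%:~R / (xdeg q (phi (a ^+ n)))%:R : R).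

Let Q : R := (q ^ tdeg a)%:R.

Let hE : p \in [pchar E].
Proof. exact: (rmorph_pchar h hK). Qed.

Let a0 : a != 0.
Proof. by apply: contraTneq a_gt0 => ->; rewrite /tdeg drin_0 size_poly0. Qed.

Let local_limitE (y : E) : local_limit y =
  limn ((fun n => (vmin0 w (action h (a ^+ n) y))%:~R / Q ^+ n) : R^nat).
Proof.
congr (limn _); apply/funext => n; have [an0 dn] := drin_X n (phi_inj a0).
by rewrite (xdegE hp hm hq) // -/(tdeg _) dn mulnC expnM natrX.
Qed.

Let Q2 : 2 <= Q.
Proof.
rewrite /Q ler_nat (leq_trans (q_gt1 hp hm hq)) // -{1}(expn1 q).
by rewrite leq_exp2l ?(q_gt1 hp hm hq).
Qed.

Let vge_phi (b : A) : b != 0 -> exists C : R, forall y : E,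
  `|(vmin0 w (action h b y))%:~R - (q ^ tdeg b)%:R * (vmin0 w y)%:~R| <= C.
Proof.
move=> b0; have [c c0 hc] := vge_coef_bound w h (phi b).
exists ((1 + (q ^ tdeg b)%:Z) * c)%:~R => y.
have := vmin0_teval hw hp hm hq (phi_inj b0) (vi_lead_coef hw h b0) c0 hc y.
by rewrite -(ler_int R) intr_norm rmorphB rmorphM /= -pmulrn.
Qed.

(** The constant is uniform in y, so it can be used along a whole orbit. *)
Let tate : exists C : R, forall y : E,
  cvgn ((fun n => (vmin0 w (action h (a ^+ n) y))%:~R / Q ^+ n) : R^nat) /\
  `|local_limit y - (vmin0 w y)%:~R| <= C.
Proof.
have [C hC] := vge_phi a0; exists C => y.
have [|cv] := @tate_limit R (fun n => (vmin0 w (action h (a ^+ n) y))%:~R) Q C Q2.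
  by move=> n; rewrite actionXS.
by rewrite local_limitE expr0 action1.
Qed.

Lemma local_limit_le0 (y : E) : local_limit y <= 0.
Proof.
have [C hC] := tate; have [cv _] := hC y.
rewrite local_limitE; apply: limr_le => //; near=> n.
rewrite mulr_le0_ge0 ?invr_ge0 ?exprn_ge0 ?lerz0 ?vmin0_le0 //.
Unshelve. all: by end_near. Qed.

(** As b commutes with a^n, [vge_phi] at the points phi_(a^n)(y) shows that the sequence for
    phi_b(y) differs from q^(deg b) times that for y by at most C/Q^n. *)
Lemma local_limit_action (b : A) (y : E) : b != 0 ->
  local_limit (action h b y) = (q ^ tdeg b)%:R * local_limit y.
Proof.
move=> b0; have [C hC] := vge_phi b0; have [C' hC'] := tate.
have [cv _] := hC' y; have [cvb _] := hC' (action h b y).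
have Q0 : 0 < Q by apply: lt_le_trans Q2.
have C0 : 0 <= C by apply: le_trans (hC 0).
rewrite !local_limitE.
set u := (fun n => _ / Q ^+ n) in cvb *; set v := (fun n => _ / Q ^+ n) in cv *.
have g0 : ((fun n => C / Q ^+ n : R) @ \oo --> (0 : R))%classic.
  have -> : (fun n => C / Q ^+ n : R) = geometric C Q^-1.
    by apply/funext => n; rewrite /geometric /= exprVn.
  apply: cvg_geometric; rewrite gtr0_norm ?invr_gt0 // invf_lt1 //.
  by apply: lt_le_trans Q2; rewrite ltr1n.
suff d0 : ((fun n => u n - (q ^ tdeg b)%:R * v n) @ \oo --> (0 : R))%classic.
  apply: (@cvg_lim R) => //; rewrite -[X in (_ --> X)%classic]add0r.
  have -> : u = (fun n => u n - (q ^ tdeg b)%:R * v n) \+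
      ((fun=> (q ^ tdeg b)%:R) \* v) by apply/funext => n /=; rewrite subrK.
  by apply: cvgD => //; apply: cvgM => //; apply: cvg_cst.
apply: (@squeeze_cvgr _ _ _ _ (fun n => - (C / Q ^+ n)) (fun n => C / Q ^+ n)).
- near=> n.
  have e : u n - (q ^ tdeg b)%:R * v n =
      ((vmin0 w (action h b (action h (a ^+ n) y)))%:~R -
      (q ^ tdeg b)%:R * (vmin0 w (action h (a ^+ n) y))%:~R) / Q ^+ n.
    by rewrite /u /v actionC //; ring.
  have := hC (action h (a ^+ n) y).
  rewrite -(ler_pM2r (x := (Q ^+ n)^-1)) ?invr_gt0 ?exprn_gt0 //.
  rewrite -[X in _ * X <= _]gtr0_norm ?invr_gt0 ?exprn_gt0 // -normrM -e.
  by rewrite ler_norml.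
- by rewrite -oppr0; apply: cvgN.
- exact: g0.
Unshelve. all: by end_near. Qed.

(** Along the orbit of y under t both sides are multiplied by exactly q^r, while by [tate] their
    difference stays bounded; hence it is zero. *)
Lemma local_limit_large (C : int) (y : E) : 0 <= C ->
  (forall l, vge w (- C) (h (phi t)`_l)) -> y != 0 -> vi w y < - C ->
  local_limit y = (vi w y)%:~R.
Proof.
move=> C0 hC y0 yC.
have t0 : t != 0 by apply: contraTneq phit_neq0 => ->; rewrite drin_0 eqxx.
have q1 := q_gt1 hp hm hq.
have large n : action h (t ^+ n) y != 0 /\
    vi w (action h (t ^+ n) y) = ((q ^ r) ^ n)%:Z * vi w y.
  elim: n => [|n [IH0 IH]]; first by rewrite expr0 action1 expn0 mul1r.
  rewrite actionXS //; have qn : (0 < (q ^ r) ^ n)%N by rewrite !expn_gt0 (ltn_trans _ q1).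
  have [|n0 nE] := teval_large hw hp hm hq phit_neq0 (vi_lead_coef hw h t0) C0 hC IH0.
    by rewrite IH; nia.
  by split=> //; rewrite nE IH sizet /= mulrA -PoszM -expnS.
have [C' hC'] := tate.
apply/eqP/negPn/negP => ne; pose e := `|local_limit y - (vi w y)%:~R|.
have e_gt0 : 0 < e by rewrite normr_gt0 subr_eq0.
have bd n : ((q ^ r) ^ n)%:R * e <= C'.
  have [_] := hC' (action h (t ^+ n) y); have [n0 nE] := large n.
  have tn0 : t ^+ n != 0.
    by have [+ _] := drin_X n phit_neq0; apply: contraNneq => ->; rewrite drin_0.
  rewrite local_limit_action // vmin0E // nE min_r; last first.
    by rewrite mulr_ge0_le0 // (le_trans (ltW yC)) // oppr_le0.
  have [_ ->] := drin_X n phit_neq0.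
  rewrite tdegt mulnC expnM rmorphM /= -pmulrn -mulrBr normrM.
  by rewrite ger0_norm ?ler0n.
have C'0 : 0 <= C' / e by rewrite divr_ge0 ?(ltW e_gt0) // (le_trans _ (bd 0%N)) ?mulr_ge0 ?ltW.
have := archi_boundP C'0; set n := Num.bound _.
rewrite ltr_pdivrMr // ltNge => /negP; apply.
apply: le_trans (bd n); rewrite ler_pM2r // ler_nat.
apply: ltnW; apply: ltn_expl.
by rewrite -(expn0 q) ltn_exp2l.
Qed.

Lemma local_limit_integral (y : E) :
  (forall b l, vge w 0 (h (phi b)`_l)) -> vge w 0 y -> local_limit y = 0.
Proof.
move=> hb hy; rewrite local_limitE.
have -> : (fun n => (vmin0 w (action h (a ^+ n) y))%:~R / Q ^+ n : R) = fun=> 0.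
  apply/funext => n; suff -> : vmin0 w (action h (a ^+ n) y) = 0 by rewrite mul0r.
  apply/eqP; rewrite eq_le vmin0_le0 //=; apply: vmin0_vge => //.
  rewrite /action (@tevalE q _ _ h _ y _ (leqnn _)); apply: (vge_sum hw) => l _.
  rewrite -[0]addr0; apply: (vgeM hw) => //.
  by rewrite -(mulr0 (q ^ l)%:Z); apply: (vgeX hw).
exact: lim_cst.
Qed.

End LocalHeights.

End DrinfeldModules.

Local Open Scope classical_set_scope.
Local Open Scope ring_scope.

(** * The coordinate ring of the curve *)

Lemma seq_maximum (I : eqType) (s : seq I) (g : I -> nat) :
  s != [::] -> exists2 x, x \in s & forall y, y \in s -> (g y <= g x)%N.
Proof.
elim: s => [|x s IH] // _; have [->|/IH[z zs zmax]] := eqVneq s [::].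
  by exists x => [|y]; rewrite inE ?eqxx // => /eqP ->.
have [le|lt] := leqP (g z) (g x).
  exists x => [|y]; rewrite inE ?eqxx // => /predU1P[->|/zmax] //.
  by move=> /leq_trans; apply.
exists z => [|y]; rewrite inE ?zs ?orbT // => /predU1P[->|/zmax] //.
exact: ltnW.
Qed.

(** The term of largest degree cannot be cancelled by the others. *)
Lemma sum_distinct_sizes_neq0 (K : fieldType) (I : eqType) (s : seq I)
    (F : I -> {poly K}) :
  s != [::] -> uniq s -> {in s, forall x, F x != 0} ->
  {in s &, injective (fun x => size (F x))} -> \sum_(x <- s) F x != 0.
Proof.
move=> s0 us F0 Finj; have [x xs xmax] := seq_maximum (fun x => size (F x)) s0.
rewrite (big_rem x) //= -size_poly_gt0 size_polyDl ?size_poly_gt0 ?F0 //.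
rewrite -[size (F x)]prednK ?size_poly_gt0 ?F0 // ltnS.
rewrite big_seq_cond; apply: leq_trans (size_sum _ _ _) _.
apply/bigmax_leqP_seq => y _; rewrite andbT (mem_rem_uniq) // !inE => /andP[yx ys].
rewrite -ltnS prednK ?size_poly_gt0 ?F0 // ltn_neqAle xmax // andbT.
by apply: contraNneq yx => /Finj ->.
Qed.

Section CoordinateRing.
Context {R : realType} {Fq F : fieldType} {jF : {rmorphism Fq -> F}}.
Hypothesis hF : function_field jF R.
Context {vinf : F -> \bar int} {A : comNzRingType} {eA : {rmorphism A -> F}}.
Hypotheses (eA_inj : injective eA) (hA : range eA = regular_away jF vinf).

Lemma const_lift_exists (k : Fq) : exists a : A, eA a = jF k.
Proof.
have : regular_away jF vinf (jF k).
  move=> v [hv hj] _; have [->|k0] := eqVneq k 0.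
    by rewrite rmorph0 (val_zero hv) leey.
  by rewrite hj.
by rewrite -hA => -[a _ e]; exists a.
Qed.

(** The inclusion of the constant field in [A], recovered through [eA] because constants are regular
    everywhere. *)
Definition const_lift (k : Fq) : A := sval (cid (const_lift_exists k)).

Lemma const_liftE (k : Fq) : eA (const_lift k) = jF k.
Proof. exact: (svalP (cid (const_lift_exists k))). Qed.

Lemma const_lift0 : const_lift 0 = 0.
Proof. by apply: eA_inj; rewrite const_liftE !rmorph0. Qed.

Lemma const_liftB (k l : Fq) : const_lift (k - l) = const_lift k - const_lift l.
Proof. by apply: eA_inj; rewrite rmorphB !const_liftE rmorphB. Qed.

Lemma const_lift_mulV (k : Fq) : k != 0 -> const_lift k * const_lift k^-1 = 1.
Proof.
by move=> k0; apply: eA_inj; rewrite rmorphM !const_liftE -rmorphM divff // !rmorph1.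
Qed.

Lemma coordinate_ring_mulf_eq0 (a b : A) : a * b = 0 -> a != 0 -> b = 0.
Proof.
move=> ab a0; apply: eA_inj; rewrite rmorph0; apply/eqP.
have : eA a * eA b == 0 by rewrite -rmorphM ab rmorph0.
rewrite mulf_eq0 => /orP[/eqP ea|//].
by case/eqP: a0; apply: eA_inj; rewrite ea rmorph0.
Qed.

(** Transcendence degree 1 forces a polynomial relation over the constants between any two elements.
    It is stored as the list of its exponent pairs with nonzero coefficients. *)
Lemma algebraic_relation (b e : A) : exists s : seq (nat * nat),
  exists k : nat * nat -> Fq, [/\ s != [::], uniq s,
    {in s, forall n, k n != 0} &
    \sum_(n <- s) const_lift (k n) * (b ^+ n.1 * e ^+ n.2) = 0].
Proof.
pose z (l : 'I_2) : F := if l == 0 then eA b else eA e.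
have nind : ~ alg_independent (range jF) z.
  move=> ind; have : (2%:R%:E <= trdeg R (range jF) setT)%E.
    by apply: ereal_sup_ubound; exists 2%N => //; exists z.
  by rewrite (hF.2) leNgt lte_fin ltr1n.
have [P [hP [Pz P0]]] : exists P : mpoly.mpoly 2 F,
    (forall m, range jF (mpoly.mcoeff m P)) /\ mpoly.meval z P = 0 /\ P <> 0.
  apply: contrapT => nP; apply: nind => P hP Pz; apply: contrapT => P0.
  by apply: nP; exists P.
pose kc m : Fq := sval (cid2 (hP m)).
have kcE m : jF (kc m) = mpoly.mcoeff m P by rewrite /kc; case: cid2.
pose dg (m : mpoly.multinom 2) : nat * nat :=
  (mpoly.fun_of_multinom m 0, mpoly.fun_of_multinom m 1).
pose gd (n : nat * nat) : mpoly.multinom 2 :=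
  mpoly.Multinom [tuple (if l == 0 then n.1 else n.2) | l < 2].
have dgK : cancel dg gd.
  move=> m; apply/mpoly.mnmP => l; rewrite mpoly.mnmE.
  case: l => [[|[|//]] lt] /=; congr (mpoly.fun_of_multinom m _); exact: val_inj.
exists [seq dg m | m <- mpoly.msupp P], (fun n => kc (gd n)); split.
- case: (mpoly.msupp P) (mpoly.msupp_eq0 P) => [|//].
  by rewrite eqxx => /esym/eqP.
- by rewrite map_inj_uniq ?mpoly.msupp_uniq //; apply: can_inj dgK.
- move=> _ /mapP[m mP ->]; rewrite dgK; move: mP; rewrite mpoly.mcoeff_msupp -kcE.
  by apply: contraNneq => ->; rewrite rmorph0.
- rewrite big_map; apply: eA_inj; rewrite rmorph0 -Pz mpoly.mevalE rmorph_sum.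
  apply: eq_bigr => m _; rewrite /= !rmorphM const_liftE dgK kcE /=; congr (_ * _).
  rewrite big_ord_recl big_ord1 /z /= !rmorphXn /=.
  by congr (_ * _ ^+ mpoly.fun_of_multinom m _); apply: val_inj.
Qed.

(** * Injectivity of phi and degrees of nonconstant elements *)

Section DrinfeldOnCurve.
Variables (p m q : nat).
Hypotheses (hp : prime p) (hm : (0 < m)%N) (hq : q = (p ^ m)%N).
Context {K : fieldType} {i : {rmorphism A -> K}} {phi : A -> {poly K}}.
Hypothesis hphi : drinfeld_module q i phi.

Lemma phi_sum (I : Type) (s : seq I) (P : pred I) (f : I -> A) :
  phi (\sum_(x <- s | P x) f x) = \sum_(x <- s | P x) phi (f x).
Proof. exact: (big_morph _ (drin_add hphi) (drin_0 hphi)). Qed.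

Lemma phi_unit (a b : A) : a * b = 1 -> phi a != 0 /\ tdeg phi a = 0%N.
Proof.
move=> ab; have := drin_mul hphi a b; rewrite ab (drin_one hphi) => e.
have a0 : phi a != 0.
  apply/negP => /eqP a0; move: e; rewrite a0 /tmul size_poly0 big_ord0 => /eqP.
  by rewrite oner_eq0.
have b0 : phi b != 0.
  apply/negP => /eqP b0; move: e; rewrite b0 /tmul big1 => [/eqP|l _].
    by rewrite oner_eq0.
  by rewrite size_poly0 big_ord0.
split=> //; have := congr1 (fun f : {poly K} => (size f).-1) e.
by rewrite /tdeg (size_tmul hp hm hq) // size_poly1 /=; lia.
Qed.

Lemma phi_const_lift (k : Fq) : k != 0 -> phi (const_lift k) != 0 /\ tdeg phi (const_lift k) = 0%N.
Proof. by move=> /const_lift_mulV; apply: phi_unit. Qed.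

(* An element e with [deg phi_e > 0] satisfies no relation with constant
   coefficients, while a relation between e and an element b of the kernel would
   give one after dividing by a power of b. *)
Lemma phi_injective (b : A) : b != 0 -> phi b != 0.
Proof.
move=> b0; apply/negP => /eqP pb0; have [e e1] := drin_nontriv hphi.
have [s [k [s0 us ks rel]]] := algebraic_relation b e.
(* The least power of b that occurs, by which the relation is divided. *)
have [n0 n0s n0min] : exists2 x, x \in s & forall y, y \in s -> (x.1 <= y.1)%N.
  pose M := (\sum_(x <- s) x.1)%N.
  have Mle x : x \in s -> (x.1 <= M)%N by move=> xs; rewrite /M (big_rem x) //= leq_addr.
  have [x xs xmax] := seq_maximum (fun x : nat * nat => (M - x.1)%N) s0.
  exists x => // y ys; have /= := xmax _ ys; have := Mle _ ys; have := Mle _ xs.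
  by clearbody M; move: x.1 y.1 => *; lia.
have rel' : \sum_(n <- s) const_lift (k n) * (b ^+ (n.1 - n0.1) * e ^+ n.2) = 0.
  have bn : b ^+ n0.1 != 0.
    elim: (n0.1) => [|j IH]; first by rewrite expr0 oner_neq0.
    by rewrite exprS; apply: contraNneq b0 => h;
      apply/eqP; apply: (coordinate_ring_mulf_eq0 _ IH); rewrite mulrC.
  apply: (coordinate_ring_mulf_eq0 _ bn); rewrite -[RHS]rel mulr_sumr.
  rewrite big_seq [RHS]big_seq; apply: eq_bigr => n ns.
  by rewrite -{2}(subnKC (n0min n ns)) exprD; ring.
(* After the division the terms free of b have images of distinct degrees in tau, while phi kills
   all the others. *)
pose s1 := [seq n <- s | n.1 == n0.1].
have e0 : phi e != 0 by rewrite -size_poly_gt0 (ltn_trans _ e1).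
have term n : n \in s -> n.1 = n0.1 ->
    phi (const_lift (k n) * (b ^+ (n.1 - n0.1) * e ^+ n.2)) != 0 /\
    tdeg phi (const_lift (k n) * (b ^+ (n.1 - n0.1) * e ^+ n.2)) = (n.2 * tdeg phi e)%N.
  move=> ns n1; rewrite n1 subnn expr0 mul1r.
  have [c0 cd] := phi_const_lift (ks n ns); have [en0 ed] := drin_X hp hm hq hphi n.2 e0.
  rewrite /tdeg (drin_mul hphi); split; first exact: (tmul_neq0 hp hm hq).
  by rewrite (size_tmul hp hm hq) // -[(size (phi (const_lift _))).-1]/(tdeg phi _) cd -ed.
have : \sum_(n <- s1) phi (const_lift (k n) * (b ^+ (n.1 - n0.1) * e ^+ n.2)) != 0.
  apply: sum_distinct_sizes_neq0.
  - have n0s1 : n0 \in s1 by rewrite mem_filter eqxx.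
    by apply: contraTneq n0s1 => ->.
  - exact: filter_uniq.
  - by move=> n; rewrite mem_filter => /andP[/eqP n1 ns]; have [] := term n ns n1.
  - move=> n n'; rewrite !mem_filter => /andP[/eqP n1 ns] /andP[/eqP n1' ns'] /=.
    have [_ d] := term n ns n1; have [_ d'] := term n' ns' n1'.
    move=> /(congr1 predn); rewrite -/(tdeg phi _) -[RHS]/(tdeg phi _) d d'.
    move=> /eqP; rewrite eqn_pmul2r; last by rewrite /tdeg; lia.
    by case: n n' n1 n1' {ns ns' d d'} => ? ? [? ?] /= -> -> /eqP ->.
rewrite big_filter; suff -> : \sum_(n <- s | n.1 == n0.1)
    phi (const_lift (k n) * (b ^+ (n.1 - n0.1) * e ^+ n.2)) = phi 0.
  by rewrite (drin_0 hphi) eqxx.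
rewrite -rel' phi_sum [RHS](bigID (fun n => n.1 == n0.1)) /= [X in _ = _ + X]big1_seq ?addr0 //.
move=> n /andP[n1 ns]; have : (n.1 - n0.1 = (n.1 - n0.1).-1.+1)%N.
  by rewrite prednK // subn_gt0 ltn_neqAle eq_sym n1 n0min.
move=> ->; rewrite exprS mulrCA -mulrA (drin_mul hphi) pb0.
by rewrite /tmul size_poly0 big_ord0.
Qed.

(** If phi_a were a constant al, commuting with some phi_e of degree s > 0 would give al^(q^s) = al.
    Then phi kills a^(q^s) - a, so by injectivity a is algebraic over the constants. *)
Lemma tdeg_gt0 (a : A) : nonconstant jF (eA a) -> (0 < tdeg phi a)%N.
Proof.
move=> ha; rewrite lt0n; apply/negP => /eqP a0; apply: ha.
have q1 := q_gt1 hp hm hq.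
have [e e1] := drin_nontriv hphi; pose s := tdeg phi e.
have s0 : (0 < s)%N by rewrite /s /tdeg; lia.
have e0 : phi e != 0 by rewrite -size_poly_gt0 (ltn_trans _ e1).
have [->|an0] := eqVneq a 0.
  by exists 'X; rewrite ?polyX_eq0 // rmorph0 map_polyX rootX.
have pa0 := phi_injective an0.
have aE : phi a = (lead_coef (phi a))%:P.
  by rewrite lead_coefE -/(tdeg phi a) a0; apply: size1_polyC; move: a0; rewrite /tdeg; lia.
set al := lead_coef (phi a) in aE.
have alq : al ^+ (q ^ s) = al.
  have := coef_tmul_top hp hm hq pa0 e0.
  rewrite -(drin_mul hphi) mulrC (drin_mul hphi) addnC.
  rewrite (coef_tmul_top hp hm hq e0 pa0) -/al -/(tdeg phi a) a0 expn0 expr1 -/(tdeg phi e) -/s.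
  rewrite mulrC => /mulIf; apply; by rewrite lead_coef_eq0.
have aX n : phi (a ^+ n) = (al ^+ n)%:P.
  elim: n => [|n IH]; first by rewrite !expr0 (drin_one hphi).
  rewrite !exprS (drin_mul hphi) IH aE; apply/polyP => l.
  rewrite (coef_tmul hp hm hq) big_ord_recl /= big1 ?addr0.
    by rewrite !coefC eqxx subn0 expn0 expr1; case: eqP; rewrite ?mulr0.
  by move=> j _; rewrite coefC /= mul0r.
have phiN x : phi (- x) = - phi x.
  by apply: (addIr (phi x)); rewrite -(drin_add hphi) !addNr (drin_0 hphi).
have aq : a ^+ (q ^ s) - a = 0.
  apply: contrapT => /eqP/phi_injective/negP; apply.
  by rewrite (drin_add hphi) phiN aX aE alq subrr.
exists ('X^(q ^ s) - 'X).
  rewrite -size_poly_gt0 size_polyDl ?size_polyXn // size_polyN size_polyX ltnS.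
  by apply: (leq_trans q1); rewrite -{1}(expn1 q) leq_exp2l.
rewrite rmorphB /= map_polyXn map_polyX /root !hornerE -rmorphXn -rmorphB aq.
by rewrite rmorph0.
Qed.

End DrinfeldOnCurve.

End CoordinateRing.

(** * Polynomials in [t] over the constant field *)

Section PolynomialsInT.
Context {R : realType} {Fq : finFieldType} {F : fieldType} {jF : {rmorphism Fq -> F}}.
Context {vinf : F -> \bar int} {A : comNzRingType} {eA : {rmorphism A -> F}}.
Hypotheses (eA_inj : injective eA) (hA : range eA = regular_away jF vinf).
Variables (t : A) (N : nat).

(** Row vectors index the polynomials of degree below [N], which makes the index type a finite
    abelian group suitable for counting. *)
Definition poly_in_t (P : 'rV[Fq]_N) : A :=
  \sum_(j < N) const_lift hA (P 0 j) * t ^+ j.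

Lemma poly_in_tB : {morph poly_in_t : P Q / P - Q}.
Proof.
move=> P Q; rewrite /poly_in_t -sumrB; apply: eq_bigr => j _.
by rewrite !mxE (const_liftB eA_inj) mulrBl.
Qed.

Lemma poly_in_t_neq0 (P : 'rV[Fq]_N) : nonconstant jF (eA t) ->
  P != 0 -> poly_in_t P != 0.
Proof.
move=> ht P0; apply/negP => /eqP e; apply: ht.
pose f := \sum_(j < N) P 0 j *: 'X^j.
have fE (l : 'I_N) : f`_l = P 0 l.
  rewrite coef_sum (bigD1 l) //= coefZ coefXn eqxx mulr1 big1 ?addr0 // => j jl.
  by rewrite coefZ coefXn eq_sym (inj_eq val_inj) (negPf jl) mulr0.
exists f; first by apply: contraNneq P0 => f0; apply/eqP/rowP => l; rewrite -fE f0 coef0 mxE.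
have := congr1 eA e; rewrite rmorph0 rmorph_sum => et.
rewrite /root rmorph_sum horner_sum -{2}et; apply/eqP; apply: eq_bigr => j _.
by rewrite /= map_polyZ map_polyXn hornerZ hornerXn rmorphM rmorphXn /= const_liftE.
Qed.

Lemma tdeg_poly_in_t (p m q : nat) (K : fieldType) (i : {rmorphism A -> K})
  (phi : A -> {poly K}) (P : 'rV[Fq]_N) : prime p -> (0 < m)%N -> q = (p ^ m)%N ->
  drinfeld_module q i phi -> phi t != 0 ->
  (tdeg phi (poly_in_t P) <= N.-1 * tdeg phi t)%N.
Proof.
move=> hp hm hq hphi t0; rewrite /poly_in_t.
elim/big_rec: _ => [|j x _ IH].
  by rewrite /tdeg (drin_0 hphi) size_poly0.
apply: (tdeg_add_le hphi) => //; apply: leq_trans (tdeg_mul_le hp hm hq hphi _ _) _.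
have [_ ->] := drin_X hp hm hq hphi j t0.
have -> : tdeg phi (const_lift hA (P 0 j)) = 0%N.
  have [->|P0] := eqVneq (P 0 j) 0.
    by rewrite (const_lift0 eA_inj) /tdeg (drin_0 hphi) size_poly0.
  by have [] := phi_const_lift eA_inj hA hp hm hq hphi P0.
by rewrite add0n leq_mul2r -ltnS prednK ?ltn_ord ?orbT // (leq_trans _ (ltn_ord j)).
Qed.

End PolynomialsInT.

(** * Good sets of valuations *)

(** In the sum formula all terms are nonnegative, so each vanishes. *)
Lemma good_set_integral (R : realType) (K : fieldType) (U : set (K -> \bar int))
    (d : (K -> \bar int) -> R) (z : K) : good_set U d -> z != 0 ->
  (forall v, U v -> vge v 0 z) -> forall v, U v -> v z = 0%E.
Proof.
move=> hU z0 hz v Uv; apply: contrapT => /eqP vz.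
pose D := [set v | U v /\ v z != 0%E].
have Dfin : finite_set D := good_fin hU z0.
have := good_sum hU z0; rewrite -(@fsbig_widen _ _ _ _ D) => [|u [] //|u [Uu nDu]]; last first.
  have [uz|uz] := eqVneq (u z) 0%E; first by rewrite /= uz mulr0.
  by case: nDu; split.
move=> sum0; have Dv : D v by [].
have F0 u : D u -> 0 <= d u * (fine (u z))%:~R.
  move=> [Uu _]; rewrite mulr_ge0 ?(ltW (good_deg hU Uu)) // ler0z.
  by have := hz u Uu; rewrite vge_vi.
have /eqP := pfsumr_eq0 Dfin F0 sum0 Dv; rewrite mulf_eq0 gt_eqF ?(good_deg hU) //= intr_eq0.
by move: vz; rewrite (val_vi (good_val hU Uv) z0) eqe => /negPf ->.
Qed.

(** A difference of constants is at first only integral everywhere; [good_set_integral] makes it a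
    constant. *)
Lemma constants_divring (R : realType) (K : fieldType) (U : set (K -> \bar int))
    (d : (K -> \bar int) -> R) : good_set U d ->
  GRing.divring_closed (fun x => x \in constants U).
Proof.
move=> hU.
have cst_vge (x : K) : constants U x -> forall v, U v -> vge v 0 x.
  move=> [->|h] v Uv; first exact: vge0.
  by rewrite (vgeE (good_val hU Uv)) h.
split=> [|x y /set_mem xc /set_mem yc|x y /set_mem xc /set_mem yc]; apply/mem_set.
- right=> v Uv; rewrite (val_vi (good_val hU Uv) (oner_neq0 _)).
  by rewrite (vi1 (good_val hU Uv)).
- have [->|xy] := eqVneq (x - y) 0; first by left.
  right; apply: (good_set_integral hU xy) => v Uv.
  by apply: (vgeB (good_val hU Uv)); apply: cst_vge.
- have [->|x0] := eqVneq x 0; first by left; rewrite mul0r.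
  have [->|y0] := eqVneq y 0; first by left; rewrite invr0 mulr0.
  right=> v Uv; have hv := good_val hU Uv.
  case: xc => [xE|xc]; first by rewrite xE eqxx in x0.
  case: yc => [yE|yc]; first by rewrite yE eqxx in y0.
  rewrite (val_vi hv) ?mulf_neq0 ?invr_neq0 // (viM hv) ?invr_neq0 // (viV hv) //.
  by rewrite /vi xc // yc //= subr0.
Qed.

(** A nonempty family in k satisfies the relation X_0 - z_0 = 0 with coefficients in k. *)
Lemma trdeg_self_le0 (R : realType) (E : fieldType) (k S : set E) :
  GRing.divring_closed (fun x => x \in k) -> S `<=` k -> (trdeg R k S <= 0)%E.
Proof.
move=> [k1 kB kV] Sk; apply: ge_ereal_sup => _ [n [z [Sz zi]] <-].
case: n z Sz zi => [|n] z Sz zi; first by [].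
have k0 : 0 \in k by rewrite -(subrr 1) kB.
pose P : mpoly.mpoly n.+1 E := mpoly.mpolyX E (mpoly.mnm1 ord0) -
  mpoly.mpolyC n.+1 (z ord0).
have kP m : k (mpoly.mcoeff m P).
  apply/set_mem; rewrite /P mpoly.mcoeffB mpoly.mcoeffX mpoly.mcoeffC; apply: kB.
    by case: (_ == _).
  by case: (_ == _); rewrite ?mulr1 ?mulr0 //; apply/mem_set/Sk.
have /(congr1 (mpoly.meval (fun=> z ord0 + 1))) : P = 0.
  by apply: zi => //; rewrite mpoly.mevalB mpoly.mevalXU mpoly.mevalC subrr.
rewrite mpoly.mevalB mpoly.mevalXU mpoly.mevalC mpoly.meval0 addrC addKr.
by move/eqP; rewrite oner_eq0.
Qed.

Lemma divring_closed_image (K E : fieldType) (h : {rmorphism K -> E}) (k : set K) :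
  GRing.divring_closed (fun x => x \in k) ->
  GRing.divring_closed (fun x => x \in h @` k).
Proof.
move=> [k1 kB kV]; split.
- by apply/mem_set; exists 1; [exact: set_mem | rewrite rmorph1].
- move=> _ _ /set_mem[x kx <-] /set_mem[y ky <-]; apply/mem_set.
  by exists (x - y); [apply/set_mem/kB; exact: mem_set | rewrite rmorphB].
- move=> _ _ /set_mem[x kx <-] /set_mem[y ky <-]; apply/mem_set.
  by exists (x / y); [apply/set_mem/kV; exact: mem_set | rewrite fmorph_div].
Qed.

(** Without bad places every coefficient of every phi_b is integral on all of [U], hence constant by
    the sum formula. Then gamma = 1 already gives transcendence degree at most 0. *)
Lemma exists_bad_place (R : realType) (p m q : nat) (A : comNzRingType)
    (K Kalg : fieldType) (iK : {rmorphism K -> Kalg})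
    (U : set (K -> \bar int)) (d : (K -> \bar int) -> R) (phi : A -> {poly K}) :
  prime p -> (0 < m)%N -> q = (p ^ m)%N -> phi 0 = 0 ->
  good_set U d -> (0 < rel_modular_trdeg R q phi iK (constants U))%E ->
  exists2 v, U v & bad_reduction phi v.
Proof.
move=> hp hm hq phi0 hU; apply: contraPP => nbad; apply/negP; rewrite -leNgt.
have cstphi b l : constants U (phi b)`_l.
  have [->|bl0] := eqVneq (phi b)`_l 0; first by left.
  right; apply: (good_set_integral hU bl0) => v Uv; rewrite (vgeE (good_val hU Uv)).
  rewrite leNgt; apply/negP => lt; apply: nbad; exists v => //; exists b.
    by apply: contraNneq bl0 => ->; rewrite phi0 coef0.
  by left; exists l.
have tmul1l (f : {poly Kalg}) : tmul q 1%:P f = f.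
  apply/polyP => l; rewrite (coef_tmul hp hm hq) big_ord_recl /= big1 ?addr0.
    by rewrite coefC eqxx mul1r subn0 expn0 expr1.
  by move=> j _; rewrite coefC mul0r.
have tmul1r (f : {poly Kalg}) : tmul q f 1%:P = f.
  apply/polyP => l; rewrite (coef_tmul hp hm hq) big_ord_recr /= big1 ?add0r.
    by rewrite subnn coefC eqxx expr1n mulr1.
  move=> j _; rewrite coefC subn_eq0 leqNgt ltn_ord /= (qexp0 hp hm hq) mulr0 //.
apply: ge_ereal_inf; exists (trdeg R (iK @` constants U)
    (compositum (iK @` constants U) (field_of_definition (conj_drinfeld q phi iK 1)))).
  by exists 1; rewrite /= ?oner_neq0.
have Kc := divring_closed_image iK (constants_divring hU).
apply: trdeg_self_le0 => //; apply: smallest_sub => //.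
move=> z [//|]; move: z; apply: smallest_sub => // _ [b [n ->]].
exists (phi b)`_n => //; by rewrite /conj_drinfeld invr1 tmul1l tmul1r coef_map.
Qed.

(** * Ramification and the place below a given one *)

Section Extensions.
Context {K : fieldType} {L : fieldExtType K}.
Implicit Types (w : L -> \bar int) (v : K -> \bar int).

Lemma ramificationP w v e : valuation v -> is_ramification w v e ->
  ramification w v = e.
Proof.
move=> hv [e0 he]; apply: xget_unique => // e' [e'0 he'].
have [x xE] := val_onto hv 1; have := he x; rewrite he' xE -!EFinM !mulr1.
by move=> [].
Qed.

Lemma ramification_spec w v : valuation v -> lies_over w v ->
  is_ramification w v (ramification w v).
Proof. by move=> hv [_ [e he]]; rewrite (ramificationP hv he). Qed.

Lemma ramification_gt0 w v : valuation v -> lies_over w v ->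
  (0 < ramification w v)%N.
Proof. by move=> hv /(ramification_spec hv) []. Qed.

Lemma vi_in_alg w v (x : K) : valuation v -> lies_over w v -> x != 0 ->
  vi w x%:A = (ramification w v)%:Z * vi v x.
Proof.
move=> hv wv x0; have [_ /(_ x)] := ramification_spec hv wv.
by rewrite /vi => ->; rewrite (val_vi hv x0).
Qed.

Lemma vge_in_alg w v (k : int) (x : K) : valuation v -> lies_over w v ->
  vge v k x -> vge w ((ramification w v)%:Z * k) x%:A.
Proof.
move=> hv wv; have [->|x0] := eqVneq x 0; first by rewrite scale0r => *; apply: vge0.
rewrite !vge_vi ?scaler_eq0 ?negb_or ?x0 ?oner_neq0 // (vi_in_alg hv wv x0).
exact: ler_wpM2l.
Qed.

(** From e v = e' v', where v and v' both take the value 1, the indices e and e' divide each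
    other. *)
Lemma lies_over_uniq w v v' : valuation v -> valuation v' ->
  lies_over w v -> lies_over w v' -> v = v'.
Proof.
move=> hv hv' wv wv'.
have r0 := ramification_gt0 hv wv; have r0' := ramification_gt0 hv' wv'.
have e (x : K) : x != 0 ->
    (ramification w v)%:Z * vi v x = (ramification w v')%:Z * vi v' x.
  by move=> x0; rewrite -(vi_in_alg hv wv x0) -(vi_in_alg hv' wv' x0).
have unif u : valuation u -> exists2 x : K, x != 0 & vi u x = 1.
  move=> hu; have [x xE] := val_onto hu 1; exists x; last by rewrite /vi xE.
  by apply/eqP => x0; move: xE; rewrite x0 (val_zero hu).
have [x x0 xE] := unif v hv; have [x' x0' xE'] := unif v' hv'.
have := e x x0; have := e x' x0'; rewrite xE xE' !mulr1 => e1 e2.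
have rE : ramification w v = ramification w v'.
  apply/eqP; rewrite eqn_dvd; apply/andP; split.
    have : ((ramification w v)%:Z %| (ramification w v')%:Z)%Z.
      by apply/dvdzP; exists (vi v x'); rewrite -e1 mulrC.
    by rewrite dvdzE.
  have : ((ramification w v')%:Z %| (ramification w v)%:Z)%Z.
    by apply/dvdzP; exists (vi v' x); rewrite e2 mulrC.
  by rewrite dvdzE.
apply/funext => y; have [->|y0] := eqVneq y 0.
  by rewrite (val_zero hv) (val_zero hv').
rewrite (val_vi hv y0) (val_vi hv' y0); congr EFin; move: (e y y0); rewrite rE.
by apply: mulfI; rewrite eqz_nat -lt0n.
Qed.

End Extensions.

(** * Sums over the places of an extension *)

Section GlobalSums.
Context {R : realType} {K : fieldType} {U : set (K -> \bar int)}
  {d : (K -> \bar int) -> R}.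
Hypothesis hU : coherent_good_set U d.
Context {L : fieldExtType K}.

Let hG : good_set U d := coh_good hU.

Lemma val_belowE (v : K -> \bar int) (w : L -> \bar int) : U v -> lies_over w v ->
  val_below U w = v.
Proof.
move=> Uv wv; apply: xget_unique => // v' [Uv' wv'].
by apply: lies_over_uniq wv' wv; apply: (good_val hG).
Qed.

(** Otherwise the sum of the e f above v would be empty, hence 0 instead of [L:K]. *)
Lemma exists_place_over (v : K -> \bar int) : U v ->
  exists w : L -> \bar int, lies_over w v.
Proof.
move=> Uv; apply: contrapT => nw; have := coh_val hU Uv L.
rewrite (_ : [set w | _] = set0) ?fsbig_set0.
  by move=> e; have := adim_gt0 {:L}%AS; rewrite -e.
by rewrite -subset0 => w /= wv; apply: nw; exists w.
Qed.

(** The places above v contribute at least rho d(v) times the sum of the e f / [L:K], which is 1 by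
    coherence. The support is assumed finite because a sum with infinite support is 0 by default. *)
Lemma ext_sum_lower (v : K -> \bar int) (g : (L -> \bar int) -> R) (rho : R) :
  U v -> 0 < rho -> (forall w, ext_set U L w -> 0 <= g w) ->
  finite_set [set w | ext_set U L w /\ g w != 0] ->
  (forall w, lies_over w v -> rho * (ramification w v)%:R <= g w) ->
  d v * rho <= \sum_(w \in ext_set U L) ext_deg U d L w * g w.
Proof.
move=> Uv rho0 g0 gfin hg; have hv := good_val hG Uv.
set S := [set w | _] in gfin; pose s := finmap.enum_fset (fset_set S).
have us : uniq s by apply: finmap.fset_uniq.
have sS w : (w \in s) = (w \in S) by rewrite -[LHS]/(w \in fset_set S) in_fset_set.
have extW w : lies_over w v -> ext_set U L w by exists v.
(* Since rho e > 0, the places above v lie in the finite support, so both sums can be taken over the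
   list [s]. *)
have WS w : lies_over w v -> S w.
  move=> wv; split; first exact: extW.
  rewrite gt_eqF // (lt_le_trans _ (hg w wv)) // mulr_gt0 // ltr0n.
  exact: (ramification_gt0 hv).
have dimL : (0 < \dim {:L})%N := adim_gt0 {:L}%AS.
have := coh_val hU Uv L; pose W := [set w : L -> \bar int | lies_over w v].
rewrite (@fsbigE _ _ _ _ _ [seq w <- s | w \in W]) ?filter_uniq //; last 2 first.
- by move=> w; rewrite /= mem_filter => /andP[/set_mem].
- by move=> w wv; rewrite mem_filter sS !mem_set //; apply: WS.
rewrite big_filter_cond (eq_bigl (fun w => w \in W)) => [|w]; last by rewrite andbb.
move=> dimE.
rewrite (@fsbigE _ _ _ _ _ s) => //; last 2 first.
- by move=> w /=; rewrite sS => /set_mem[].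
- move=> w ew; rewrite sS => nS; have [->|gw] := eqVneq (g w) 0; first by rewrite mulr0.
  by case/negP: nS; apply/mem_set.
rewrite (bigID (fun w => w \in [set w | lies_over w v])) /=.
have deg0 w : ext_set U L w -> 0 <= ext_deg U d L w.
  by move=> ew; apply: ltW; apply: good_deg (coh_ext hU L) _ ew.
have low : d v * rho <= \sum_(w <- s | (w \in ext_set U L) && (w \in [set w | lies_over w v]))
    ext_deg U d L w * g w.
  have -> : d v * rho = \sum_(w <- s | w \in [set w | lies_over w v])
      d v * rho / (\dim {:L})%:R * (ramification w v * residue_degree w v)%:R.
    by rewrite -mulr_sumr -natr_sum dimE mulfVK // pnatr_eq0 -lt0n.
  rewrite [leRHS](eq_bigl (fun w => w \in [set w | lies_over w v])); last first.
    move=> w; case: (boolP (w \in [set w | lies_over w v])) => [/set_mem wv|]; rewrite ?andbF //.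
    by rewrite andbT; apply/mem_set/extW.
  apply: ler_sum => w /set_mem wv; rewrite /ext_deg (val_belowE Uv wv) natrM.
  have := hg w wv; have dv := good_deg hG Uv.
  have f0 : 0 <= (residue_degree w v)%:R * d v / (\dim {:L})%:R :> R.
    by rewrite divr_ge0 ?mulr_ge0 // ltW.
  move=> /(ler_wpM2l f0); apply: le_trans; rewrite le_eqVlt; apply/orP; left.
  by apply/eqP; ring.
apply: le_trans low _; rewrite lerDl; apply: sumr_ge0 => w /andP[/set_mem ew _].
by rewrite mulr_ge0 ?deg0 ?g0.
Qed.

Lemma fsum_add (I : choiceType) (P : set I) (f g : I -> R) :
  finite_set [set x | P x /\ f x != 0] -> finite_set [set x | P x /\ g x != 0] ->
  \sum_(x \in P) (f x + g x) = \sum_(x \in P) f x + \sum_(x \in P) g x.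
Proof.
move=> ff gf; set S := [set x | _ /\ f x != 0] in ff; set T := [set x | _] in gf.
have STf : finite_set (S `|` T) by rewrite finite_setU.
have STP : S `|` T `<=` P by move=> x [[]|[]].
have wid (k : I -> R) : (forall x, f x = 0 -> g x = 0 -> k x = 0) ->
    \sum_(x \in P) k x = \sum_(x \in S `|` T) k x.
  move=> hk; rewrite [RHS](@fsbig_widen _ _ _ _ _ P) // => x [Px nx] /=.
  apply: hk; apply: contrapT => /eqP ne; apply: nx; [left|right]; by split.
by rewrite !wid ?fsbig_split // => x -> ->; rewrite addr0.
Qed.

End GlobalSums.

(** * Heights *)

Section Heights.
Variables (p m q : nat).
Hypotheses (hp : prime p) (hm : (0 < m)%N) (hq : q = (p ^ m)%N).
Context {R : realType} {A : comNzRingType} {K : fieldType} (hK : p \in [pchar K]).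
Context {U : set (K -> \bar int)} {d : (K -> \bar int) -> R}.
Hypothesis hU : coherent_good_set U d.
Context {i : {rmorphism A -> K}} {phi : A -> {poly K}}.
Hypothesis hphi : drinfeld_module q i phi.
Hypothesis phi_inj : forall b, b != 0 -> phi b != 0.
Variables (t : A) (r : nat).
Hypotheses (r_gt0 : (0 < r)%N) (sizet : size (phi t) = r.+1).
Hypothesis leadt : lead_coef (phi t) = 1.
Variables (L : fieldExtType K) (a : A).
Hypothesis a_gt0 : (0 < tdeg phi a)%N.

Local Notation S0 := [set v | U v /\ bad_reduction phi v].
Local Notation h := (in_alg L).
Local Notation act := (action q phi (in_alg L)).
Local Notation H w y := (local_limit (R := R) q phi (in_alg L) w a y).
Local Notation ht := (height q phi U d a).

Let hG : good_set U d := coh_good hU.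
Let hGL : good_set (ext_set U L) (ext_deg U d L) := coh_ext hU L.
Let q1 : (1 < q)%N := q_gt1 hp hm hq.
Let badP {v} (hv : valuation v) :=
  bad_reductionP hp hm hq hK hphi phi_inj r_gt0 sizet leadt hv.

Let H_le0 {w : L -> \bar int} (hw : valuation w) (z : L) : H w z <= 0 :=
  local_limit_le0 hp hm hq hK hphi phi_inj r_gt0 sizet leadt (in_alg L) hw a_gt0 z.

Let H_large {w : L -> \bar int} (hw : valuation w) {C : int} {z : L} :=
  @local_limit_large _ _ _ hp hm hq _ _ hK _ _ hphi phi_inj _ _ r_gt0 sizet leadt
    R L (in_alg L) w hw a a_gt0 C z.

Lemma finite_bad_places : finite_set S0.
Proof.
apply: (@sub_finite_set _ _ (\bigcup_(l in `I_r.+1)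
    [set v | (phi t)`_l != 0 /\ (U v /\ v (phi t)`_l != 0%E)])).
  move=> v [Uv] /(badP (good_val hG Uv))[l nl].
  have l0 : (phi t)`_l != 0 by apply: contraNneq nl => ->; apply: vge0.
  exists l; first by rewrite /= -sizet ltnNge; apply: contraNN l0 => /(nth_default 0) ->.
  split=> //; split=> //; apply: contraNneq nl => vl.
  by rewrite (vgeE (good_val hG Uv)) vl.
apply: bigcup_finite; first exact: finite_II.
move=> l _; have [l0|l0] := eqVneq (phi t)`_l 0.
  by apply: (@sub_finite_set _ _ set0) => // v [].
by apply: sub_finite_set (good_fin hG l0) => v [].
Qed.

Lemma good_place_integral (v : K -> \bar int) (w : L -> \bar int) : U v ->
  ~ bad_reduction phi v -> lies_over w v -> forall b l, vge w 0 (h (phi b)`_l).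
Proof.
move=> Uv nb wv b l; have hv := good_val hG Uv.
rewrite -(mulr0 (ramification w v)%:Z); apply: (vge_in_alg hv wv).
rewrite (vgeE hv) leNgt; apply/negP => lt; apply: nb; exists b; last by left; exists l.
by apply: contraTneq lt => ->; rewrite (drin_0 hphi) coef0 (val_zero hv).
Qed.

(** A pole at a good place is treated by [local_limit_large] with C = 0; without a pole the limit is
    at most 0 <= w(z). *)
Lemma local_limit_ge_good (v : K -> \bar int) (w : L -> \bar int) (z : L) : U v ->
  ~ bad_reduction phi v -> lies_over w v -> z != 0 -> H w z <= (vi w z)%:~R.
Proof.
move=> Uv nb wv z0; have hw := proj1 wv.
have [neg|pos] := ltP (vi w z) 0.
  rewrite (H_large hw (C := 0)) // => l.
  by rewrite oppr0; apply: (good_place_integral Uv nb wv).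
apply: (le_trans (H_le0 hw z)).
by rewrite ler0z.
Qed.

(** The limit is 0 at a good place where z is integral. At the remaining places z or a coefficient
    of phi_t has nonzero valuation, so the sum defining [height] is finite. *)
Lemma finite_local_limit (z : L) : finite_set [set w | ext_set U L w /\ H w z != 0].
Proof.
pose T (x : L) := [set w | ext_set U L w /\ w x != 0%E].
pose T' (x : L) := [set w | x != 0 /\ T x w].
apply: (@sub_finite_set _ _ (T' z `|` \bigcup_(l in `I_r.+1) T' (h (phi t)`_l))); last first.
  have fT x : finite_set (T' x).
    have [x0|x0] := eqVneq x 0; first
      by apply: (@sub_finite_set _ _ set0) => // w []; rewrite x0 eqxx.
    by apply: sub_finite_set (good_fin hGL x0) => w [].
  rewrite finite_setU; split=> //; apply: bigcup_finite; first exact: finite_II.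
  by move=> l _; apply: fT.
move=> w [[v Uv wv] Hw]; have hv := good_val hG Uv; have hw := proj1 wv.
have [bad|good] := pselect (bad_reduction phi v).
  right; have [l nl] := (badP hv).1 bad.
  have l0 : (phi t)`_l != 0 by apply: contraNneq nl => ->; apply: vge0.
  exists l; first by rewrite /= -sizet ltnNge; apply: contraNN l0 => /(nth_default 0) ->.
  have hl0 : h (phi t)`_l != 0 by rewrite fmorph_eq0.
  split=> //; split; first by exists v.
  rewrite (val_vi hw hl0) eqe (vi_in_alg hv wv l0) mulf_eq0 negb_or.
  move: nl; rewrite vge_vi // => nl; apply/andP; split.
    by rewrite eqz_nat -lt0n (ramification_gt0 hv).
  by apply: contraNneq nl => ->.
left; have int := good_place_integral Uv good wv.
have nz : ~~ vge w 0 z.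
  apply: contraNN Hw => z0; apply/eqP.
  exact: (local_limit_integral hp hm hq hphi phi_inj hw a_gt0 int z0).
have z0 : z != 0 by apply: contraNneq nz => ->; apply: vge0.
split=> //; split; first by exists v.
move: nz; rewrite (val_vi hw z0) vge_vi // eqe.
by apply: contraNneq => ->.
Qed.

Lemma heightE (z : L) :
  ht z = \sum_(w \in ext_set U L) ext_deg U d L w * - H w z.
Proof.
by apply: eq_fsbigr => w _; rewrite /local_height mulNr mulrN.
Qed.

Lemma height_action (b : A) (z : L) : b != 0 -> ht (act b z) = (q ^ tdeg phi b)%:R * ht z.
Proof.
move=> b0; rewrite !heightE mulr_fsumr; apply: eq_fsbigr => w /set_mem[v Uv wv].
rewrite (local_limit_action hp hm hq hK hphi phi_inj r_gt0 sizet leadt _ (proj1 wv) a_gt0) //.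
by rewrite -mulrN mulrCA.
Qed.

(** By [local_limit_large] the limit at each w above v is w(z), which is at most -e(w|v); then
    [ext_sum_lower] applies with rho = 1. *)
Lemma height_ge_pole (v : K -> \bar int) (z : L) (C : int) : U v -> 0 < C ->
  (forall l, vge v (- C) (phi t)`_l) -> z != 0 ->
  (forall w, lies_over w v -> vi w z < - ((ramification w v)%:Z * C)) ->
  d v <= ht z.
Proof.
move=> Uv C0 hC z0 hz; rewrite heightE -[d v]mulr1.
have hv := good_val hG Uv.
apply: (ext_sum_lower hU) => //.
- move=> w [u Uu wu]; rewrite oppr_ge0.
  exact: (H_le0 (proj1 wu) z).
- by apply: sub_finite_set (finite_local_limit z) => w /= [? +]; rewrite oppr_eq0.
move=> w wv; have r0 := ramification_gt0 hv wv.
rewrite (H_large (proj1 wv) (C := (ramification w v)%:Z * C)) //; last 3 first.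
- by rewrite mulr_ge0 // ltW.
- by move=> l; rewrite -mulrN; apply: (vge_in_alg hv wv).
- exact: hz.
rewrite mul1r pmulrn -mulrNz ler_int; have := hz w wv.
have : (ramification w v)%:Z * 1 <= (ramification w v)%:Z * C by rewrite ler_wpM2l.
rewrite mulr1; move: (vi w z) (_ * C) => x y; lia.
Qed.

(** The sum formula allows w(z) to be added to each local term without changing the total. The new
    terms are nonnegative, at good places by [local_limit_ge_good] and at bad ones because both
    parts are, and above v0 they are at least e(w|v0)/k. *)
Lemma height_ge_zero (v0 : K -> \bar int) (z : L) (k : nat) : S0 v0 -> (0 < k)%N ->
  z != 0 ->
  (forall v w, S0 v -> lies_over w v -> (ramification w v)%:Z <= k%:Z * vi w z) ->
  d v0 / k%:R <= ht z.
Proof.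
move=> Sv0 k0 z0 hz; have Uv0 := proj1 Sv0.
have vfin : finite_set [set w | ext_set U L w /\ (vi w z)%:~R != 0 :> R].
  apply: sub_finite_set (good_fin hGL z0) => w [ew wz]; split=> //.
  have [v Uv wv] := ew; rewrite (val_vi (proj1 wv) z0) eqe.
  by move: wz; rewrite intr_eq0.
have efin (F : (L -> \bar int) -> R) :
    finite_set [set w | ext_set U L w /\ F w != 0] ->
    finite_set [set w | ext_set U L w /\ ext_deg U d L w * F w != 0].
  by apply: sub_finite_set => w /= [ew]; rewrite mulf_eq0 negb_or => /andP[].
have Hfin : finite_set [set w | ext_set U L w /\ - H w z != 0].
  by apply: sub_finite_set (finite_local_limit z) => w /= [? +]; rewrite oppr_eq0.
have -> : ht z = \sum_(w \in ext_set U L) ext_deg U d L w * (- H w z + (vi w z)%:~R).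
  under eq_fsbigr do rewrite mulrDr.
  by rewrite fsum_add ?(good_sum hGL z0) ?addr0 ?heightE //; apply: efin.
apply: (ext_sum_lower hU) => //.
- by rewrite invr_gt0 ltr0n.
- move=> w [v Uv wv]; have hv := good_val hG Uv.
  have [bad|good] := pselect (bad_reduction phi v); last first.
    by rewrite addrC subr_ge0; apply: (local_limit_ge_good Uv good wv).
  apply: addr_ge0.
    rewrite oppr_ge0.
    exact: (H_le0 (proj1 wv) z).
  have := hz v w (conj Uv bad) wv; rewrite ler0z => h.
  have : 0 <= k%:Z * vi w z by apply: le_trans h.
  by rewrite pmulr_rge0.
- apply: (@sub_finite_set _ _ ([set w | ext_set U L w /\ - H w z != 0] `|`
      [set w | ext_set U L w /\ (vi w z)%:~R != 0 :> R])).
    move=> w [ew s0]; have [Hw|Hw] := eqVneq (- H w z) 0; last by left.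
    by right; split=> //; move: s0; rewrite Hw add0r.
  by rewrite finite_setU.
move=> w wv; have hv := good_val hG Uv0.
have H0 : 0 <= - H w z.
  rewrite oppr_ge0.
  exact: (H_le0 (proj1 wv) z).
apply: (le_trans (y := (vi w z)%:~R)); last by rewrite lerDr.
rewrite mulrC ler_pdivrMr ?ltr0n // mulrC.
have := hz v0 w Sv0 wv; rewrite -(ler_int R) rmorphM /= -!pmulrn.
by [].
Qed.

(** * Purely inseparable points and the pigeonhole at all bad places *)

Section PerfectPoints.
Variable n : nat.

(** The exponent n is fixed because all phi_b(z) share it with z. *)
Definition radicial (z : L) : Prop := exists c : K, z ^+ (p ^ n) = c%:A.

Lemma radicial_action (b : A) (z : L) : radicial z -> radicial (act b z).
Proof.
move=> [c zc]; have hL : p \in [pchar L] := rmorph_pchar (in_alg L) hK.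
have pn : [pchar L].-nat (p ^ n)%N.
  by rewrite pnatX (eq_pnat _ (pcharf_eq hL)) pnat_id.
exists (\sum_(l < size (phi b)) (phi b)`_l ^+ (p ^ n) * c ^+ (q ^ l)).
rewrite /action (tevalE q _ _ (leqnn _)).
have p0 : (0 < p ^ n)%N by rewrite expn_gt0 prime_gt0.
rewrite (big_morph (fun x : L => x ^+ (p ^ n)) (id1 := 0) (op1 := +%R)); first last.
- by rewrite expr0n gtn_eqF.
- by move=> x y; rewrite exprDn_pchar.
rewrite -in_algE rmorph_sum; apply: eq_bigr => l _.
by rewrite exprMn -exprM mulnC exprM zc rmorphM !rmorphXn.
Qed.

(** For every u above v one has p^n u(z) = e(u|v) v(c), so u(z)/e(u|v) does not depend on u. *)
Lemma radicial_transport (v : K -> \bar int) (w w' : L -> \bar int) (z : L) :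
  valuation v -> lies_over w v -> lies_over w' v -> radicial z -> z != 0 ->
  (ramification w' v)%:Z * vi w z = (ramification w v)%:Z * vi w' z.
Proof.
move=> hv wv wv' [c zc] z0.
have c0 : c != 0.
  apply: contraNneq z0 => c0; move: zc; rewrite c0 scale0r => /eqP.
  by rewrite expf_eq0 => /andP[].
have e u : lies_over u v -> (p ^ n)%:Z * vi u z = (ramification u v)%:Z * vi v c.
  by move=> uv; rewrite -(viX (proj1 uv)) // zc (vi_in_alg hv uv c0).
have p0 : (p ^ n)%:Z != 0 by rewrite eqz_nat -lt0n expn_gt0 prime_gt0.
apply: (mulfI p0); rewrite mulrCA (e w wv) mulrCA [RHS]mulrCA (e w' wv').
by rewrite mulrCA.
Qed.

End PerfectPoints.

Lemma bad_place_coef (v : K -> \bar int) : S0 v -> exists C (i0 : nat),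
  [/\ 0 < C, (i0 <= r)%N, (phi t)`_i0 != 0, vi v (phi t)`_i0 = - C &
      forall l, vge v (- C) (phi t)`_l].
Proof.
move=> [Uv bad]; have hv := good_val hG Uv; have [l nl] := (badP hv).1 bad.
have l0 : (phi t)`_l != 0 by apply: contraNneq nl => ->; apply: vge0.
have lr : (l < r.+1)%N.
  by rewrite -sizet ltnNge; apply: contraNN l0 => /(nth_default 0) ->.
have [j j0 jmin] : exists2 j : 'I_r.+1, (phi t)`_j != 0 &
    forall j' : 'I_r.+1, (phi t)`_j' != 0 -> vi v (phi t)`_j <= vi v (phi t)`_j'.
  case: (@Order.TotalTheory.arg_minP _ int _ (Ordinal lr) (fun j => (phi t)`_j != 0)
    (fun j => vi v (phi t)`_j) l0) => j j0 jm.
  by exists j.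
exists (- vi v (phi t)`_j), j; split=> //.
- have := jmin (Ordinal lr) l0; move: nl; rewrite vge_vi //= => nl le.
  by rewrite oppr_gt0 (le_lt_trans le) // ltNge.
- by rewrite -ltnS.
- by rewrite opprK.
move=> l'; rewrite opprK; have [lr'|lr'] := ltnP l' r.+1; last first.
  by rewrite [in X in vge _ _ X]nth_default ?vge0 ?sizet.
have [->|l'0] := eqVneq (phi t)`_l' 0; first exact: vge0.
by rewrite vge_vi // (jmin (Ordinal lr')).
Qed.

(** Induction over the places, each passing to a subgroup of index at most q^(3r) by
    [local_pigeonhole]. The hypothesis for j = 0, 1, 2 bounds the poles of u, phi_t(u) and
    phi_t(phi_t(u)). *)
Lemma pigeonhole_all_places (T : finZmodType) (u : T -> L) (n : nat)
    (vs : seq (K -> \bar int)) :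
  {morph u : x y / x - y} -> (forall P, radicial n (u P)) ->
  (forall v, v \in vs -> S0 v) ->
  (forall v C w j P, v \in vs -> 0 < C -> (forall l, vge v (- C) (phi t)`_l) ->
     lies_over w v -> (j <= 2)%N ->
     vge w (- ((ramification w v)%:Z * C)) (act (t ^+ j) (u P))) ->
  exists HH : {set T}, [/\ subtractive HH,
    (#|T| <= q ^ (3 * r * size vs) * #|HH|)%N &
    forall P v w, P \in HH -> v \in vs -> lies_over w v -> u P != 0 ->
      (ramification w v)%:Z <= (q ^ (2 * r))%:Z * vi w (u P)].
Proof.
have hL : p \in [pchar L] := rmorph_pchar (in_alg L) hK.
move=> uB urad; elim: vs => [|v vs IH] hS hpole.
  exists [set: T]%SET; split=> //; first by split=> [|x y _ _]; rewrite finset.in_setT.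
  by rewrite muln0 expn0 mul1n cardsT.
have [||HH [HHs HHc HHv]] := IH.
- by move=> v' v's; apply: hS; rewrite inE v's orbT.
- by move=> v' C w j P v's; apply: hpole; rewrite inE v's orbT.
have vvs : v \in v :: vs by rewrite inE eqxx.
have Sv := hS v vvs; have hv := good_val hG (proj1 Sv).
have [C [i0 [C0 i0r i00 i0C hC]]] := bad_place_coef Sv.
(* One place above v is enough: [radicial_transport] carries the result to the others. *)
have [w wv] := exists_place_over hU (L := L) (proj1 Sv).
have hw := proj1 wv; have r0 := ramification_gt0 hv wv.
have FE z : (qlin q r (fun l => h (phi t)`_l)).[z] = act t z.
  by rewrite -(teval_qlin _ _ _ (r := r)) ?sizet.
have [||||||||||H' [H'H H's H'c H'v]] := @local_pigeonhole L w hw T q r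
    (fun l => h (phi t)`_l) ((ramification w v)%:Z * C) i0 HH u q1 r_gt0.
- have -> : (phi t)`_r = 1 by rewrite -leadt lead_coefE sizet.
  exact: rmorph1.
- by rewrite mulr_gt0.
- by move=> l _; rewrite -mulrN; apply: (vge_in_alg hv wv).
- exact: i0r.
- by rewrite fmorph_eq0.
- by rewrite (vi_in_alg hv wv i00) i0C mulrN.
- by move=> x y; rewrite !FE (actionBr hp hq).
- exact: uB.
- exact: HHs.
- move=> P _; rewrite !FE; split.
  + by have := hpole v C w 0%N P vvs C0 hC wv isT; rewrite expr0 (action1 hphi).
  + by have := hpole v C w 1%N P vvs C0 hC wv isT; rewrite expr1.
  + have := hpole v C w 2%N P vvs C0 hC wv isT.
    by rewrite expr2 (actionM hp hm hq hphi).
exists H'; split=> //.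
  apply: (leq_trans HHc); rewrite /= mulnS expnD.
  move: H'c; move: (q ^ (3 * r * size vs))%N (q ^ (3 * r))%N #|HH| #|H'| => x y z z' le.
  by rewrite [(y * x)%N]mulnC -mulnA leq_mul2l le orbT.
move=> P v' w' PH'; rewrite inE => /predU1P[->|v's] wv' uP0; last first.
  by apply: HHv => //; apply: (fintype.subsetP H'H).
have := H'v P PH' uP0; have tr := radicial_transport hv wv wv' (urad P) uP0.
have r0' := ramification_gt0 hv wv'.
have e1 : (ramification w v)%:Z * 1 <= (ramification w v)%:Z * C by rewrite ler_wpM2l.
move=> e2; have : (ramification w v)%:Z <= (q ^ (2 * r))%:Z * vi w (u P).
  by apply: le_trans e2; rewrite mulr1 in e1.
rewrite -(ler_pM2l (x := (ramification w' v)%:Z)) // mulrCA tr.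
by rewrite mulrC mulrCA ler_pM2l.
Qed.

End Heights.

(** * The lower bound for the height *)

Lemma seq_positive_lower_bound (R : realType) (I : eqType) (s : seq I) (f : I -> R) :
  (forall x, x \in s -> 0 < f x) ->
  exists2 e, 0 < e & forall x, x \in s -> e <= f x.
Proof.
elim: s => [|x s IH] hs; first by exists 1.
have [|e e0 he] := IH; first by move=> y ys; apply: hs; rewrite inE ys orbT.
exists (Num.min e (f x)); first by rewrite lt_min e0 hs ?inE ?eqxx.
by move=> y; rewrite inE ge_min => /predU1P[->|/he ->//]; rewrite lexx orbT.
Qed.

Theorem mainTheorem9 (R : realType)
  (p m q : nat) (hp : prime p) (hm : (0 < m)%N) (hq : q = (p ^ m)%N)
  (Fq : finFieldType) (hFq : #|Fq| = q)
  (F : fieldType) (jF : {rmorphism Fq -> F}) (hF : function_field jF R)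
  (vinf : F -> \bar int) (hvinf : closed_point jF vinf)
  (A : comNzRingType) (eA : {rmorphism A -> F}) (eA_inj : injective eA)
  (hA : range eA = regular_away jF vinf)
  (K : fieldType) (hK : p \in [pchar K]) (jK : {rmorphism Fq -> K})
  (Kalg : closedFieldType) (iK : {rmorphism K -> Kalg})
  (hKalg : forall z : Kalg, algebraicOver iK z)
  (U : set (K -> \bar int)) (d : (K -> \bar int) -> R)
  (hU : coherent_good_set U d)
  (i : {rmorphism A -> K}) (phi : A -> {poly K})
  (hphi : drinfeld_module q i phi)
  (hmod : (0 < rel_modular_trdeg R q phi iK (constants U))%E)
  (t : A) (ht : nonconstant jF (eA t))
  (r : nat) (c : nat -> K) (hphit : phi t = \poly_(l < r.+1) c l)
  (hmonic : c r = 1)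
  (x : Kalg) (hxper : perfect_closure p iK x) (hxtors : ~ torsion q phi iK x)
  (L : fieldExtType K) (sigma : {rmorphism L -> Kalg})
  (hsigma : forall z : K, sigma z%:A = iK z)
  (y : L) (hy : sigma y = x)
  (a : A) (ha : nonconstant jF (eA a)) :
  let S0 := [set v | U v /\ bad_reduction phi v] in
  let s := #|` fset_set S0| in
  let bound := inf (d @` S0) / q%:R ^+ (4 * r * (r + 1) ^ 2 * s + 3 * r) in
  bound < height q phi U d a y /\ 0 < bound.
Proof.
move=> S0 s bound.
have q1 : (1 < q)%N := q_gt1 hp hm hq.
have phi_inj := phi_injective hF eA_inj hA hp hm hq hphi.
have c0 : c r != 0 by rewrite hmonic oner_neq0.
have sizet : size (phi t) = r.+1 by rewrite hphit size_poly_eq.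
have leadt : lead_coef (phi t) = 1 by rewrite hphit lead_coef_poly.
have tdt : tdeg phi t = r by rewrite /tdeg sizet.
have r_gt0 : (0 < r)%N by rewrite -tdt; apply: (tdeg_gt0 hF eA_inj hA hp hm hq hphi).
have a_gt0 := tdeg_gt0 hF eA_inj hA hp hm hq hphi ha.
have t0 : phi t != 0 by rewrite -size_poly_gt0 sizet.
have hG := coh_good hU.
have [v0 Uv0 bad0] := exists_bad_place hp hm hq (drin_0 hphi) hG hmod.
have Sv0 : S0 v0 by [].
have Sfin : finite_set S0 :=
  finite_bad_places hp hm hq hK hU hphi phi_inj r_gt0 sizet leadt.
pose vs : seq (K -> \bar int) := finmap.enum_fset (fset_set S0).
have vsS v : (v \in vs) = (v \in S0) by rewrite -[LHS]/(v \in fset_set S0) in_fset_set.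
have dpos v : S0 v -> 0 < d v by move=> [Uv _]; apply: good_deg hG _ Uv.
pose I := inf (d @` S0).
(* The infimum is over a finite nonempty set of positive numbers. *)
have I0 : 0 < I.
  have [|e e0 he] := @seq_positive_lower_bound R _ vs d.
    by move=> v; rewrite vsS => /set_mem; apply: dpos.
  apply: (lt_le_trans e0); apply: lb_le_inf; first by exists (d v0), v0.
  by move=> _ [v Sv <-]; apply: he; rewrite vsS; apply/mem_set.
have Ile v : S0 v -> I <= d v.
  move=> Sv; apply: ge_inf; last by exists v.
  by exists 0 => _ [v' Sv' <-]; apply/ltW/dpos.
set D := (4 * r * (r + 1) ^ 2 * s + 3 * r)%N in bound *.
pose hgt := height q phi U d a y.
have [n [c1 xc]] := hxper.
have yrad : radicial p n y.
  exists c1; apply: (fmorph_inj sigma); rewrite rmorphXn /= hy xc; exact/esym/hsigma.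
have hL : p \in [pchar L] := rmorph_pchar (in_alg L) hK.
have nontors b : b != 0 -> action q phi (in_alg L) b y != 0.
  move=> b0; apply/negP => /eqP e; apply: hxtors; exists b => //.
  have := congr1 sigma e; rewrite rmorph0 /action (tevalE q _ _ (leqnn _)).
  rewrite (tevalE q _ _ (leqnn _)) rmorph_sum => es; rewrite -[RHS]es.
  by apply: eq_bigr => l _; rewrite rmorphM rmorphXn /= hsigma hy.
(* The strict inequality k < D turns this weak bound into the strict one claimed. *)
suff [k kD kI] : exists2 k, (k < D)%N & I <= (q ^ k)%:R * hgt.
  have qk k' : (0 : R) < (q ^ k')%:R by rewrite ltr0n expn_gt0 (ltn_trans _ q1).
  have h0 : 0 < hgt by rewrite -(pmulr_rgt0 _ (qk k)); apply: lt_le_trans kI.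
  rewrite /bound -/I -/hgt -natrX; split; last by rewrite divr_gt0.
  rewrite ltr_pdivrMr //; apply: (le_lt_trans kI).
  by rewrite mulrC ltr_pM2l // ltr_nat ltn_exp2l.
(* If this fails, every phi_b(y) with b nonzero of degree below [D] has height less than d(v) for
   each bad v. *)
apply: contrapT => nk.
have small k : (k < D)%N -> (q ^ k)%:R * hgt < I.
  by move=> kD; rewrite ltNge; apply/negP => kI; apply: nk; exists k.
have s_gt0 : (0 < s)%N.
  have v0s : v0 \in vs by rewrite vsS; apply/mem_set.
  by rewrite /s -[X in (0 < X)%N]/(size vs) -has_predT; apply/hasP; exists v0.
(* The degree of a polynomial in t is at most (N - 1)r = 3rs r. The extra 2r accounts first for
   multiplication by t^j, j <= 2, and later for the factor q^(2r) in the size of the zeros. *)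
have ltD k : (k <= 2 * r + 3 * r * s * r)%N -> (k < D)%N.
  have le : (3 * r * s * r <= 4 * r * (r + 1) ^ 2 * s)%N.
    rewrite mulnAC leq_mul // leq_mul ?leq_mul //.
    by rewrite (leq_trans (leq_addr 1 r)) // leq_pmulr ?addn1.
  move: le; rewrite /D; move: (3 * r * s * r)%N (4 * r * _ * s)%N => x1 x2.
  by move: r_gt0; clear; lia.
(* One more than the exponent 3rs lost over the s bad places, so that the surviving subgroup is
   nontrivial. *)
pose N := (3 * r * s).+1.
pose u (P : 'rV[Fq]_N) := action q phi (in_alg L) (poly_in_t hA t P) y.
have uB : {morph u : P Q / P - Q}.
  by move=> P Q; rewrite /u (poly_in_tB eA_inj) (actionBl hphi).
have tdu (P : 'rV[Fq]_N) : (tdeg phi (poly_in_t hA t P) <= 3 * r * s * r)%N.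
  by have := tdeg_poly_in_t eA_inj hA P hp hm hq hphi t0; rewrite tdt.
have urad P : radicial p n (u P) by apply: radicial_action.
have ht_act := height_action hp hm hq hK hphi phi_inj r_gt0 sizet leadt a_gt0.
have [||HH [HHs HHc HHv]] := pigeonhole_all_places hp hm hq hK hU hphi phi_inj r_gt0
    sizet leadt (vs := vs) uB urad.
- by move=> v; rewrite vsS => /set_mem.
- move=> v C w j P; rewrite vsS => /set_mem Sv C0 hC wv j2.
  have hv := good_val hG (proj1 Sv).
  rewrite /u -(actionM hp hm hq hphi) //; set b := t ^+ j * _.
  (* Too deep a pole at one place above v is, by transport, equally deep relative to ramification at
     all of them. Then [height_ge_pole] gives height at least d(v), against [small]. *)
  set z := action _ _ _ _ _; apply: contrapT => /negP nz.
  have z0 : z != 0 by apply: contraNneq nz => ->; apply: vge0.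
  have b0 : b != 0.
    by apply: contraNneq z0 => b0; rewrite /z b0 (action0 hphi).
  have tdb : (tdeg phi b <= 2 * r + 3 * r * s * r)%N.
    apply: leq_trans (tdeg_mul_le hp hm hq hphi _ _) _.
    have [_ ->] := drin_X hp hm hq hphi j t0.
    by rewrite leq_add // tdt leq_mul2r j2 orbT.
  have : d v <= height q phi U d a z.
    apply: (height_ge_pole hp hm hq hK hU hphi phi_inj r_gt0 sizet leadt a_gt0
      (proj1 Sv) C0 hC z0) => w' wv'.
    have := radicial_transport hp hv wv wv' (radicial_action q hp hK b yrad) z0.
    have r0 := ramification_gt0 hv wv; have r0' := ramification_gt0 hv wv'.
    move: nz; rewrite vge_vi // -ltNge => nz e.
    rewrite -(ltr_pM2l (x := (ramification w v)%:Z)) // -e.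
    have -> : (ramification w v)%:Z * - ((ramification w' v)%:Z * C) =
      (ramification w' v)%:Z * - ((ramification w v)%:Z * C) by ring.
    by rewrite ltr_pM2l.
  rewrite ht_act // leNgt => /negP; apply; apply: (lt_le_trans (small _ _) (Ile v Sv)).
  exact: ltD tdb.
(* The subgroup has at least q^N / q^(3rs) = q elements. *)
have [P PHH P0] : exists2 P, P \in HH & P != 0.
  apply: contrapT => nP; have : HH \subset [set 0]%SET.
    apply/fintype.subsetP => P PHH; rewrite finset.in_set1; apply/negPn/negP => P0.
    by apply: nP; exists P.
  move=> /subset_leq_card; rewrite cards1 => HH1.
  move: HHc; rewrite card_mx hFq mul1n -[size vs]/s /N expnS => HHc.
  have := leq_trans HHc (leq_mul (leqnn _) HH1).
  by rewrite muln1 -{2}[(q ^ _)%N]mul1n leq_pmul2r ?expn_gt0 ?(ltn_trans _ q1) // leqNgt q1.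
have b0 := poly_in_t_neq0 hA ht P0.
have uP0 : u P != 0 by apply: nontors.
have k0 : (0 < q ^ (2 * r))%N by rewrite expn_gt0 (ltn_trans _ q1).
(* The point u P has a zero of definite size at every bad place, so q^(2r + deg) times the height of
   y is at least d(v0). As 2r + deg < D, this contradicts [small]. *)
have : d v0 / (q ^ (2 * r))%:R <= height q phi U d a (u P).
  apply: (height_ge_zero hp hm hq hK hU hphi phi_inj r_gt0 sizet leadt a_gt0 Sv0) => //.
  by move=> v w Sv wv; apply: HHv => //; rewrite vsS; apply/mem_set.
rewrite ht_act // ler_pdivrMr ?ltr0n // mulrAC -natrM -expnD leNgt => /negP; apply.
apply: (lt_le_trans (small _ _) (Ile v0 Sv0)).
by apply: ltD; rewrite addnC leq_add2l tdu.
Qed.
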